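(* There is a continuous map $f:[0,1]\to[0,1]$ such that (1) the inverse limit of copies of $[0,1]$ with $f$ as the bonding map is a pseudo-arc, (2) $f$ is topologically exact, and (3) $f$ has the small folds property.
   Context: The inverse limit of copies of $[0,1]$ with bonding map $f$ is $\varprojlim([0,1],f)=\{(x_0,x_1,\ldots)\in[0,1]^{\mathbb{N}_0}: x_i=f(x_{i+1})\text{ for all } i\in\mathbb{N}_0\}$ with the topology induced from the product. The pseudo-arc is the (unique up to homeomorphism) nondegenerate hereditarily indecomposable chainable (arc-like) continuum. A map $f:X\to X$ is topologically exact if for every nonempty open set $U\subset X$ there is $n$ such that $f^n(U)=X$. Let $f:[0,1]\to[0,1]$ be continuous, $a,b\in[0,1]$, and $\delta>0$. We say $f$ is $\delta$-crooked between $a$ and $b$ if for every two points $c,d\in[0,1]$ such that $f(c)=a$ and $f(d)=b$, there is a point $c'$ between $c$ and $d$ and there is a point $d'$ between $c'$ and $d$ such that $|b-f(c')|\le\delta$ and $|a-f(d')|\le\delta$. (Here ''between'' is non-strict and does not presuppose an order: $c'$ lies in the closed interval with endpoints $c$ and $d$, and $d'$ in the closed interval with endpoints $c'$ and $d$.) A continuous $f:[0,1]\to[0,1]$ has the small folds property if for every positive number $\lambda<1$ there exist positive numbers $\beta<\lambda$ and $\xi<\beta/4$ such that for every $a,b\in[0,1]$ with $|a-b|<\beta$, $f$ is $\xi$-crooked between $a$ and $b$. *)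

(* Defs.v *)
From mathcomp Require Import all_boot all_order all_algebra.
From mathcomp Require Import boolp classical_sets functions reals topology.
From mathcomp Require Import normedtype.

Set Implicit Arguments.
Unset Strict Implicit.
Unset Printing Implicit Defensive.

Import Order.TTheory GRing.Theory Num.Theory.
Import numFieldNormedType.Exports.

Local Open Scope classical_set_scope.
Local Open Scope ring_scope.

(* A notation, so that the subspace topology of [set_type] is inferred. *)
Notation unit_interval R := (set_type [set` `[(0 : R), (1 : R)]]).

Section Continua.
Variables (R : realType) (T : topologicalType).

Definition metrizes (d : T -> T -> R) : Prop :=
  [/\ forall x y, 0 <= d x y,
      forall x y, d x y = 0 <-> x = y,
      forall x y, d x y = d y x,
      forall x y z, d x z <= d x y + d y z
    & forall x (A : set T),
        nbhs x A <-> exists2 e : R, 0 < e & [set y | d x y < e] `<=` A].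

Definition continuum : Prop :=
  [/\ [set: T] !=set0, compact [set: T], connected [set: T]
    & exists d : T -> T -> R, metrizes d].

Definition nondegenerate : Prop := exists x y : T, x <> y.

(* In a continuum, metrizability of subsets is automatic. *)
Definition subcontinuum (K : set T) : Prop :=
  [/\ K !=set0, compact K & connected K].

Definition indecomposable (K : set T) : Prop :=
  forall A B : set T, subcontinuum A -> subcontinuum B ->
    K = A `|` B -> A = K \/ B = K.

Definition hereditarily_indecomposable : Prop :=
  forall K : set T, subcontinuum K -> indecomposable K.

(* Links [C i] and [C j] meet exactly when |i - j| <= 1; taking i = j, every
   link is nonempty. *)
Definition chain n (C : 'I_n -> set T) : Prop :=
  (forall i, open (C i)) /\
  (forall i j : 'I_n,
     C i `&` C j !=set0 <-> (i <= j.+1)%N && (j <= i.+1)%N).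

(* On a compact space this does not depend on the choice of the compatible
   metric [d] (Lebesgue numbers). *)
Definition chainable : Prop :=
  exists2 d : T -> T -> R, metrizes d &
    forall e : R, 0 < e ->
      exists n (C : 'I_n -> set T),
        [/\ chain C, \bigcup_i C i = [set: T]
          & forall i x y, C i x -> C i y -> d x y < e].

Definition pseudo_arc : Prop :=
  [/\ continuum, nondegenerate, hereditarily_indecomposable & chainable].

End Continua.

(* The topology on [set_type (inverse_limit f)] is the one induced from the
   product. *)
Definition inverse_limit (T : topologicalType) (f : T -> T) :
    set (prod_topology (fun _ : nat => T)) :=
  [set x | forall i, x i = f (x i.+1)].

Definition topologically_exact (T : topologicalType) (f : T -> T) : Prop :=
  forall U : set T, open U -> U !=set0 ->
    exists n, iter n f @` U = [set: T].

Section Crookedness.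
Variable R : realType.
Local Notation I := (unit_interval R).
Implicit Types a b c d : I.

Definition between c d (x : I) : Prop :=
  Num.min (\val c) (\val d) <= \val x <= Num.max (\val c) (\val d).

Definition crooked_between (f : I -> I) (delta : R) a b : Prop :=
  forall c d, f c = a -> f d = b ->
    exists c' d', [/\ between c d c', between c' d d',
      `|\val b - \val (f c')| <= delta & `|\val a - \val (f d')| <= delta].

Definition small_folds (f : I -> I) : Prop :=
  forall lambda : R, 0 < lambda -> lambda < 1 ->
    exists beta xi : R,
      [/\ 0 < beta, beta < lambda, 0 < xi, xi < beta / 4
        & forall a b, `|\val a - \val b| < beta -> crooked_between f xi a b].

End Crookedness.

(* Main.v *)
Require Import Defs.
From mathcomp Require Import all_boot all_order all_algebra ring lra.
From mathcomp Require Import boolp classical_sets functions reals topology.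
From mathcomp Require Import normedtype realfun.
Import Order.TTheory GRing.Theory Num.Theory.
Import numFieldNormedType.Exports.

(** The map is a uniform limit of maps [f_0, f_1, ...] of the interval with
[f_(k+1) = g_k \o f_k], where [g_k] is close to the identity but very crooked.

The building block is a piecewise linear [g] which moves points by at most
[eps] and is [ga]-crooked between any two values at distance at most [eps],
with [ga / eps] as small as desired ([folding_exists]).  It comes from the
classical crooked paths, which climb from 0 to [n - 1], come back to 1 and climb
again to [n], each leg being itself crooked ([cpath_crook]).  Crooked ascents
and descents alternate periodically so as to gain one unit per period ([zig]);
rescaling by [ga] and reflecting at both ends of the interval gives [g].
Crookedness of [g] passes to [g \o f], so each stage gets folds that are small
with respect to the scale at which they occur.

The core is [perturb_crook]: if [f] has Lipschitz constant [L] and stretches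
every interval by a factor [s > 1] until it covers [0, 1], then some iterate of
[F = g \o f] is crooked between all values.  First take [n] such that
[F^n] maps every interval of length [eps / 4] onto [0, 1], and only then [ga],
so small that [L^n * ga] is negligible.  Let [c] and [d] be two points.  If [f c]
and [f d] are further apart than a constant multiple of [ga], then each half of
the segment between them is blown up by [g] to length [eps / 4] and eventually
covers everything, which gives exact crookedness.  Otherwise follow the two
orbits until they are [3 * ga] apart for the first time: there they are images by
[g] of two points at distance O([ga]), and [g] is crooked between these.  The
remaining iterates cannot be controlled pointwise, because the slope of [g] is
huge; but [g] almost commutes with translations, so a point near an interval is
sent near the image of that interval, with an error multiplied by [L] only
([perturb_push]).

Crookedness of an iterate and smallness of folds survive small uniform
perturbations, so with fast decreasing steps the limit inherits them from all
stages ([perturb_step], [limit_map]); it also inherits the stretching of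
intervals, hence exactness.

Finally let [X] be the inverse limit of a continuous surjection with arbitrarily
crooked iterates.  A coordinate of high index almost determines a point of [X] and
takes all values, which yields connectedness and chainability.  Suppose that a
subcontinuum is a union of subcontinua [A] and [B], with [p] outside [B] and [q]
outside [A].  Seen in a coordinate of high index, crookedness provides between [p]
and [q] a point near [q], and between this point and [q] a point near [p].  The
first lies in [B], so the second lies in the interval onto which [B] projects: thus
[B] comes arbitrarily near [p], although it is closed and does not contain it. *)

Set Implicit Arguments.
Unset Strict Implicit.
Unset Printing Implicit Defensive.

Local Open Scope classical_set_scope.
Local Open Scope ring_scope.

(** * Betweenness, crookedness and spread *)

Ltac lin :=
  repeat match goal with H : forall _, _ |- _ => clear H end; lra.

Lemma le_or_lt (R : realType) (x y : R) : x <= y \/ y < x.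
Proof. by case: leP => ?; [left|right]. Qed.

Definition btw (R : realType) (a b x : R) := (a <= x /\ x <= b) \/ (b <= x /\ x <= a).

Ltac btw_lra :=
  unfold btw in *;
  repeat match goal with H : _ \/ _ |- _ => destruct H end;
  repeat match goal with H : _ /\ _ |- _ => destruct H end;
  solve [left; split; lin | right; split; lin | lin].

Definition lip (R : realType) (L : R) (h : R -> R) :=
  forall x y, `|h x - h y| <= L * `|x - y|.

(** The real-variable form of crookedness, attached to the two points instead
of the values they take; it is symmetric in [c] and [d]. *)
Definition crook (R : realType) (h : R -> R) (dl c d : R) :=
  exists c' d', [/\ btw c d c', btw c' d d', `|h c' - h d| <= dl
    & `|h d' - h c| <= dl].

Definition spread (R : realType) (h : R -> R) (p q l : R) :=
  exists x y, [/\ p <= x <= q, p <= y <= q & l <= `|h x - h y|].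

Section Paths.
Variable R : realType.
Implicit Types (h : R -> R) (a b c d x y t L : R).

Lemma lip_continuous L h : lip L h -> continuous h.
Proof.
move=> hL x; apply/cvgrPdist_le => e e0.
have L0 : 0 < `|L| + 1 by have := normr_ge0 L; lin.
near=> t.
apply: (le_trans (hL _ _)).
have le1 : L * `|x - t| <= (`|L| + 1) * `|x - t|.
  by apply: ler_wpM2r => //; have := ler_norm L; lin.
apply: (le_trans le1); rewrite mulrC -ler_pdivlMr //.
near: t; apply: cvgr_dist_le; first exact: cvg_id.
by rewrite divr_gt0.
Unshelve. all: by end_near. Qed.

Lemma ivt h a b v : continuous h -> btw (h a) (h b) v ->
  exists t, btw a b t /\ h t = v.
Proof.
move=> hc.
have key p q : p <= q -> btw (h p) (h q) v -> exists t, btw p q t /\ h t = v.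
  move=> pq hv; have [||t] := @IVT _ h p q v pq.
  - exact: continuous_subspaceT.
  - by rewrite ge_min le_max; case: hv => -[-> ->]; rewrite ?orbT.
  by rewrite in_itv /= => /andP[pt tq] ht; exists t; split => //; left.
have [ab|ba] := le_or_lt a b; first exact: key.
move=> hv; have [|t [tb ht]] := key b a (ltW ba).
  by rewrite /btw in hv *; lin.
by exists t; split => //; rewrite /btw in tb *; lin.
Qed.

Lemma btwC c d x : btw c d x -> btw d c x.
Proof. by case=> -[? ?]; [right|left]. Qed.

Lemma btw_sub c d e x : btw c d e -> btw c e x -> btw c d x.
Proof. by move=> h1 h2; btw_lra. Qed.

Lemma btw_subr c d e x : btw c d e -> btw e d x -> btw c d x.
Proof. by move=> /btwC h1 /btwC h2; apply/btwC/(btw_sub h1). Qed.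

Lemma btw_mono c d x y : btw c d x -> btw c x y -> btw y d x.
Proof. by move=> h1 h2; btw_lra. Qed.

Lemma btw_trans2 c d t1 t2 c' d' :
  btw c d t1 -> btw t1 d t2 -> btw c t1 c' -> btw t2 d d' ->
  btw c d c' /\ btw c' d d'.
Proof.
move=> h1 h2 h3 h4; split; first exact: btw_sub h3.
exact: btw_subr (btw_mono h1 h3) (btw_subr h2 h4).
Qed.

Lemma btw_itv a b c d x : a <= c <= b -> a <= d <= b -> btw c d x -> a <= x <= b.
Proof. by move=> /andP[? ?] /andP[? ?] ?; apply/andP; btw_lra. Qed.

Lemma btwl c d : btw c d c.
Proof. by have /orP[?|?] := le_total c d; [left|right]. Qed.

Lemma btwr c d : btw c d d.
Proof. by have /orP[?|?] := le_total c d; [left|right]. Qed.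

Lemma crook_sym h dl c d : crook h dl c d -> crook h dl d c.
Proof.
move=> [c' [d' [H1 H2 H3 H4]]]; exists d', c'; split => //.
  exact: btwC (btw_subr H1 H2).
exact: btw_mono (btwC H1) (btwC H2).
Qed.

Lemma crook_refl h dl c d : `|h c - h d| <= dl -> crook h dl c d.
Proof.
move=> H; exists c, d; split => //; last by rewrite distrC.
  exact: btwl.
exact: btwr.
Qed.

(** If [h e] is extremal among [h c], [h e], [h d], then by the intermediate
value theorem one of the levels [h c], [h d] is also taken on the other side
of [e], and crookedness on one side of [e] is enough. *)
Lemma crook_turn_level h dl c e d : continuous h -> btw c d e ->
  (h c <= h e /\ h d <= h e) \/ (h e <= h c /\ h e <= h d) ->
  (forall x, btw c e x -> h x = h d -> crook h dl c x) ->
  (forall x, btw e d x -> h x = h c -> crook h dl x d) ->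
  crook h dl c d.
Proof.
move=> hc ced ext Hl Hr.
have left_case : btw (h c) (h e) (h d) -> crook h dl c d.
  move=> /(ivt hc)[x [cex hx]]; have [c' [d' [H1 H2 H3 H4]]] := Hl x cex hx.
  have cdx := btw_sub ced cex.
  exists c', d'; split; rewrite -?hx //; first exact: btw_sub H1.
  exact: btw_sub (btw_mono cdx H1) H2.
have right_case : btw (h e) (h d) (h c) -> crook h dl c d.
  move=> /(ivt hc)[x [cex hx]]; have [c' [d' [H1 H2 H3 H4]]] := Hr x cex hx.
  have cdx := btw_subr ced cex.
  exists c', d'; split; rewrite -?hx //; exact: btw_subr H1.
have [cd|dc] := le_or_lt (h c) (h d).
  by case: ext => -[e1 e2]; [apply: left_case|apply: right_case]; rewrite /btw; lin.
by case: ext => -[e1 e2]; [apply: right_case|apply: left_case]; rewrite /btw; lin.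
Qed.

Lemma crook_turn h dl c e d : continuous h -> btw c d e ->
  (h c <= h e /\ h d <= h e) \/ (h e <= h c /\ h e <= h d) ->
  (forall x, btw c e x -> crook h dl c x) ->
  (forall x, btw e d x -> crook h dl x d) ->
  crook h dl c d.
Proof.
by move=> hc ced ext Hl Hr; apply: (crook_turn_level hc ced ext) => x ? _;
  [exact: Hl|exact: Hr].
Qed.

Lemma btw_affine k j a b y : 0 < k ->
  btw (k * a + j) (k * b + j) y -> btw a b ((y - j) / k).
Proof.
move=> k0; rewrite /btw !ler_pdivlMr // !ler_pdivrMr // => -[] [H1 H2].
  by left; split; lin.
by right; split; lin.
Qed.

Lemma crook_affine h h' s k j v dl dl' c d : 0 < k -> `|s| * dl <= dl' ->
  (forall x, btw c d x -> h' x = s * h (k * x + j) + v) ->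
  crook h dl (k * c + j) (k * d + j) -> crook h' dl' c d.
Proof.
move=> k0 sdl hh [c' [d' [H1 H2 H3 H4]]].
have kK y : k * ((y - j) / k) + j = y by field; lin.
exists ((c' - j) / k), ((d' - j) / k).
have b1 := btw_affine k0 H1.
have b2 : btw ((c' - j) / k) d ((d' - j) / k).
  by apply: btw_affine => //; rewrite kK.
have b3 := btw_subr b1 b2.

have bc := btwl c d; have bd := btwr c d.
split => //.
  rewrite !hh // !kK.
  have -> : forall u w : R, s * u + v - (s * w + v) = s * (u - w) by move=> *; ring.
  by rewrite normrM; apply: le_trans sdl; apply: ler_wpM2l.
rewrite !hh // !kK.
have -> : forall u w : R, s * u + v - (s * w + v) = s * (u - w) by move=> *; ring.
by rewrite normrM; apply: le_trans sdl; apply: ler_wpM2l.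
Qed.

Lemma spread_le h p q p' q' l l' : p <= p' -> q' <= q -> l <= l' ->
  spread h p' q' l' -> spread h p q l.
Proof.
move=> pp qq ll [x [y [/andP[x1 x2] /andP[y1 y2] H]]]; exists x, y.
by split; [apply/andP; lin|apply/andP; lin|lin].
Qed.

Lemma spread_affine h h' s k j v p q l : 0 < k ->
  (forall x, p <= x <= q -> h' x = s * h (k * x + j) + v) ->
  spread h (k * p + j) (k * q + j) l -> spread h' p q (`|s| * l).
Proof.
move=> k0 hh [x [y [/andP[x1 x2] /andP[y1 y2] H]]].
have kK z : k * ((z - j) / k) + j = z by field; lin.
have xb : p <= (x - j) / k <= q.
  by rewrite ler_pdivlMr // ler_pdivrMr //; apply/andP; lin.
have yb : p <= (y - j) / k <= q.
  by rewrite ler_pdivlMr // ler_pdivrMr //; apply/andP; lin.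
exists ((x - j) / k), ((y - j) / k); split => //.
rewrite !hh // !kK.
have -> : forall u w : R, s * u + v - (s * w + v) = s * (u - w) by move=> *; ring.
by rewrite normrM; apply: ler_wpM2l.
Qed.

Lemma spread_ends h p q l : p <= q -> l <= `|h q - h p| -> spread h p q l.
Proof. by move=> pq H; exists q, p; split => //; apply/andP; lin. Qed.

Lemma lip_glue L h1 h2 e : lip L h1 -> lip L h2 -> h1 e = h2 e ->
  lip L (fun t => if t <= e then h1 t else h2 t).
Proof.
move=> l1 l2 he.
have key x y : x <= e -> e < y -> `|h1 x - h2 y| <= L * `|x - y|.
  move=> xe ey.
  have -> : h1 x - h2 y = (h1 x - h1 e) + (h2 e - h2 y) by rewrite he; ring.
  apply: (le_trans (ler_normD _ _)).
  apply: (le_trans (lerD (l1 _ _) (l2 _ _))).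
  rewrite -mulrDr.
  have -> // : `|x - e| + `|e - y| = `|x - y|.
  rewrite !ler0_norm; lin.
move=> x y; case: (leP x e) => xe; case: (leP y e) => ye //.
  exact: key.
by rewrite distrC (distrC x); exact: key.
Qed.

Lemma lip_affine L h s k j v : lip L h -> lip (`|s| * L * `|k|) (fun x => s * h (k * x + j) + v).
Proof.
move=> hL x y.
have -> : s * h (k * x + j) + v - (s * h (k * y + j) + v)
        = s * (h (k * x + j) - h (k * y + j)) by ring.
rewrite normrM -!mulrA; apply: ler_wpM2l => //.
apply: (le_trans (hL _ _)).
have -> : k * x + j - (k * y + j) = k * (x - y) by ring.
by rewrite normrM mulrA.
Qed.

Lemma lip_le L L' h : L <= L' -> lip L h -> lip L' h.
Proof. by move=> LL hL x y; apply: (le_trans (hL _ _)); apply: ler_wpM2r. Qed.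

End Paths.

(** * Crooked paths *)

Section CrookedPaths.
Variable R : realType.
Implicit Types (h : R -> R) (a b c d x y t L : R).

(** The crooked path climbing from 0 to [n.+1]: it goes up to [n], back to 1
and up again, each leg being a rescaled shorter path. The two base cases are
the paths too short to be folded. *)
Fixpoint cpath (n : nat) (t : R) {struct n} : R :=
  match n with
  | 0%N => t
  | S n1 => match n1 with
    | 0%N => 2 * t
    | S n2 => if t <= 1/3 then cpath n1 (3 * t)
              else if t <= 2/3 then n2.+2%:R - cpath n2 (3 * t - 1)
              else 1 + cpath n1 (3 * t - 2)
    end
  end.

Lemma cpathSS n t : cpath n.+2 t =
  if t <= 1/3 then cpath n.+1 (3 * t)
  else if t <= 2/3 then n.+2%:R - cpath n (3 * t - 1)
  else 1 + cpath n.+1 (3 * t - 2).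
Proof. by []. Qed.

Lemma cpathE0 t : cpath 0 t = t. Proof. by []. Qed.

Lemma cpathE1 t : cpath 1 t = 2 * t. Proof. by []. Qed.

Arguments cpath : simpl never.

Lemma nat_ind2 (P : nat -> Prop) :
  P 0%N -> P 1%N -> (forall n, P n -> P n.+1 -> P n.+2) -> forall n, P n.
Proof.
move=> P0 P1 PS n; suff: P n /\ P n.+1 by case.
by elim: n => [//|n [Pn PSn]]; split => //; exact: PS.
Qed.

Lemma cpath0 n : cpath n 0 = 0.
Proof.
elim/nat_ind2: n => [//||n _ IH]; first by rewrite cpathE1 mulr0.
by rewrite cpathSS ifT ?mulr0 // divr_ge0.
Qed.

Lemma cpath1 n : cpath n 1 = n.+1%:R.
Proof.
elim/nat_ind2: n => [//||n _ IH]; first by rewrite cpathE1 mulr1.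
rewrite cpathSS ifF; last by apply/negbTE; lin.
rewrite ifF; last by apply/negbTE; lin.
have -> : 3 * 1 - 2 = 1 :> R by ring.
by rewrite IH nat1r.
Qed.

Lemma cpathA n t : t <= 1/3 -> cpath n.+2 t = cpath n.+1 (3 * t).
Proof. by rewrite cpathSS => ->. Qed.

Lemma cpathB n t : 1/3 <= t -> t <= 2/3 ->
  cpath n.+2 t = n.+2%:R - cpath n (3 * t - 1).
Proof.
rewrite cpathSS => H ->; case: ifP => // H'.
have -> : t = 1/3 by lin.
have -> : 3 * (1/3) = 1 :> R by field.
by rewrite subrr cpath0 cpath1 subr0.
Qed.

Lemma cpathC n t : 2/3 <= t -> cpath n.+2 t = 1 + cpath n.+1 (3 * t - 2).
Proof.
move=> H; have [t23|t23] := le_or_lt t (2/3); last first.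
  by rewrite cpathSS ifF ?ifF //; apply/negbTE; lin.
have -> : t = 2/3 by lin.
rewrite cpathB; [|lin|lin].
have -> : 3 * (2/3) - 1 = 1 :> R by field.
have -> : 3 * (2/3) - 2 = 0 :> R by field.
by rewrite cpath0 cpath1 addr0 -[n.+2]addn1 natrD addrAC subrr add0r.
Qed.

Lemma cpath_lip n : exists2 L, 0 <= L & lip L (cpath n).
Proof.
elim/nat_ind2: n => [||n [L1 L10 h1] [L2 L20 h2]].
- by exists 1 => // x y; rewrite mul1r.
- by exists 2 => // x y; rewrite !cpathE1 -mulrBr normrM ger0_norm.
exists (3 * (L1 + L2)); first by lin.
have lA : lip (3 * (L1 + L2)) (fun t => cpath n.+1 (3 * t)).
  apply: (@lip_le _ (`|1| * L2 * `|3|)); first by rewrite !ger0_norm; lin.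
  by move=> x y; have := lip_affine 1 3 0 0 h2 x y; rewrite !mul1r !addr0.
have lB : lip (3 * (L1 + L2)) (fun t => n.+2%:R - cpath n (3 * t - 1)).
  apply: (@lip_le _ (`|-1| * L1 * `|3|)).
    by rewrite normrN !ger0_norm; lin.
  move=> x y; have := lip_affine (-1) 3 (-1) n.+2%:R h1 x y.
  by rewrite !mulN1r ![- _ + n.+2%:R]addrC.
have lC : lip (3 * (L1 + L2)) (fun t => 1 + cpath n.+1 (3 * t - 2)).
  apply: (@lip_le _ (`|1| * L2 * `|3|)); first by rewrite !ger0_norm; lin.
  move=> x y; have := lip_affine 1 3 (-2) 1 h2 x y.
  by rewrite !mul1r ![_ + 1]addrC.
have -> : cpath n.+2 = fun t => if t <= 1/3 then cpath n.+1 (3 * t)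
    else if t <= 2/3 then n.+2%:R - cpath n (3 * t - 1)
    else 1 + cpath n.+1 (3 * t - 2) by apply/funext => t; rewrite cpathSS.
apply: lip_glue => //=.
  apply: lip_glue => //=.
  have -> : 3 * (2/3) - 1 = 1 :> R by field.
  have -> : 3 * (2/3) - 2 = 0 :> R by field.
  by rewrite cpath0 cpath1 addr0 -[n.+2]addn1 natrD addrAC subrr add0r.
rewrite ifT; last by lin.
have -> : 3 * (1/3) = 1 :> R by field.
by rewrite subrr cpath0 cpath1 subr0.
Qed.

Lemma cpath_cont n : continuous (cpath n).
Proof. by have [L _] := cpath_lip n; exact: lip_continuous. Qed.

Lemma cpath_range n t : 0 <= t <= 1 -> 0 <= cpath n t <= n.+1%:R.
Proof.
elim/nat_ind2: n t => [t //|t /andP[? ?]|n IH1 IH2 t /andP[t0 t1]].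
  by rewrite cpathE1; apply/andP; lin.
have n2 : n.+2%:R = 1 + n.+1%:R :> R by rewrite nat1r.
have n3 : n.+3%:R = 1 + n.+2%:R :> R by rewrite nat1r.
have n0 : 0 <= n.+1%:R :> R by rewrite ler0n.
have [tA|tA] := le_or_lt t (1/3).
  rewrite cpathA // n3.
  by have /andP[? ?] : 0 <= cpath n.+1 (3 * t) <= n.+2%:R;
    [apply: IH2; apply/andP; lin|apply/andP; lin].
have [tB|tB] := le_or_lt t (2/3).
  rewrite cpathB ?(ltW tA) // n3.
  by have /andP[? ?] : 0 <= cpath n (3 * t - 1) <= n.+1%:R;
    [apply: IH1; apply/andP; lin|apply/andP; lin].
rewrite cpathC ?(ltW tB) // n3.
by have /andP[? ?] : 0 <= cpath n.+1 (3 * t - 2) <= n.+2%:R;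
    [apply: IH2; apply/andP; lin|apply/andP; lin].
Qed.

Lemma cpathB_ge1 n t : 1/3 <= t -> t <= 2/3 -> 1 <= cpath n.+2 t <= n.+2%:R.
Proof.
move=> h1 h2; rewrite cpathB //.
have n2 : n.+2%:R = 1 + n.+1%:R :> R by rewrite nat1r.
have /andP[? ?] : 0 <= cpath n (3 * t - 1) <= n.+1%:R.
  by apply: cpath_range; apply/andP; lin.
by apply/andP; lin.
Qed.

Lemma cpathC_ge1 n t : 2/3 <= t -> t <= 1 -> 1 <= cpath n.+2 t.
Proof.
move=> h1 h2; rewrite cpathC //.
have /andP[? ?] : 0 <= cpath n.+1 (3 * t - 2) <= n.+2%:R.
  by apply: cpath_range; apply/andP; lin.
by lin.
Qed.

Lemma cpathA_le n t : 0 <= t -> t <= 1/3 -> cpath n.+2 t <= n.+2%:R.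
Proof.
move=> h1 h2; rewrite cpathA //.
have /andP[? ?] // : 0 <= cpath n.+1 (3 * t) <= n.+2%:R.
  by apply: cpath_range; apply/andP; lin.
Qed.

Lemma cpath13 n : cpath n.+2 (1/3) = n.+2%:R.
Proof.
rewrite cpathA; last by lin.
have -> : 3 * (1/3) = 1 :> R by field.
by rewrite cpath1.
Qed.

Lemma cpath23 n : cpath n.+2 (2/3) = 1.
Proof.
rewrite cpathC //; have -> : 3 * (2/3) - 2 = 0 :> R by field.
by rewrite cpath0 addr0.
Qed.

(** Two points in different thirds are separated by the turning point 1/3 or
2/3, which is extremal and allows to conclude by induction, unless the first
value is below 1 and the second one above the height of the first turning
point; but then the two turning points themselves are within 1 of the required
values. *)
Lemma cpath_crook n c d : 0 <= c <= 1 -> 0 <= d <= 1 -> crook (cpath n) 1 c d.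
Proof.
elim/nat_ind2: n c d => [||n IH1 IH2] c d.
- move=> /andP[? ?] /andP[? ?]; apply: crook_refl.
  by rewrite ler_norml !cpathE0; apply/andP; lin.
- move=> /andP[? ?] /andP[? ?]; exists ((c + d) / 2), ((c + d) / 2).
  have ? : btw c d ((c + d) / 2).
    by have [?|?] := le_or_lt c d; [left|right]; split; lin.
  split => //; first exact: btwl.
    by rewrite ler_norml !cpathE1; apply/andP; lin.
  by rewrite ler_norml !cpathE1; apply/andP; lin.
wlog cd : c d / c <= d.
  move=> H cb db; have [/H|/ltW dc] := le_or_lt c d; first exact.
  by apply/crook_sym/H.
move=> /andP[c0 c1] /andP[d0 d1].
have hc := @cpath_cont n.+2.
have inA x y : 0 <= x <= 1/3 -> 0 <= y <= 1/3 -> crook (cpath n.+2) 1 x y.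
  move=> xb yb; apply: (@crook_affine _ (cpath n.+1) _ 1 3 0 0 1) => //.
  - by rewrite normr1 mulr1.
  - move=> z /(btw_itv xb yb) /andP[_ z1].
    by rewrite cpathA // mul1r !addr0.
  - by case/andP: xb => ? ?; case/andP: yb => ? ?; apply: IH2; apply/andP; lin.
have inB x y : 1/3 <= x <= 2/3 -> 1/3 <= y <= 2/3 -> crook (cpath n.+2) 1 x y.
  move=> xb yb; apply: (@crook_affine _ (cpath n) _ (-1) 3 (-1) n.+2%:R 1) => //.
  - by rewrite normrN normr1 mulr1.
  - move=> z /(btw_itv xb yb) /andP[z0 z1].
    by rewrite cpathB // mulN1r addrC.
  - by case/andP: xb => ? ?; case/andP: yb => ? ?; apply: IH1; apply/andP; lin.
have inC x y : 2/3 <= x <= 1 -> 2/3 <= y <= 1 -> crook (cpath n.+2) 1 x y.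
  move=> xb yb; apply: (@crook_affine _ (cpath n.+1) _ 1 3 (-2) 1 1) => //.
  - by rewrite normr1 mulr1.
  - move=> z /(btw_itv xb yb) /andP[z0 z1].
    by rewrite cpathC // mul1r addrC.
  - by case/andP: xb => ? ?; case/andP: yb => ? ?; apply: IH2; apply/andP; lin.
have inAB x y : 0 <= x <= 1/3 -> 1/3 <= y <= 2/3 -> crook (cpath n.+2) 1 x y.
  move=> /andP[x0 x1] /andP[y0 y1]; apply: (@crook_turn _ _ _ _ (1/3)) => //.
  - by left.
  - left; rewrite cpath13; split; first exact: cpathA_le.
    by case/andP: (cpathB_ge1 n y0 y1).
  - by move=> z /(@btw_itv _ 0 (1/3)) zb; apply: inA; [apply/andP|apply: zb; apply/andP; lin].
  - by move=> z /(@btw_itv _ (1/3) (2/3)) zb; apply: inB; [apply: zb; apply/andP; lin|apply/andP].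
have inBC x y : 1/3 <= x <= 2/3 -> 2/3 <= y <= 1 -> crook (cpath n.+2) 1 x y.
  move=> /andP[x0 x1] /andP[y0 y1]; apply: (@crook_turn _ _ _ _ (2/3)) => //.
  - by left.
  - right; rewrite cpath23; split; last exact: cpathC_ge1.
    by case/andP: (cpathB_ge1 n x0 x1).
  - by move=> z /(@btw_itv _ (1/3) (2/3)) zb; apply: inB; [apply/andP|apply: zb; apply/andP; lin].
  - by move=> z /(@btw_itv _ (2/3) 1) zb; apply: inC; [apply: zb; apply/andP; lin|apply/andP].
have [cA|cA] := le_or_lt c (1/3); have [dA|dA] := le_or_lt d (1/3); try lin.
- by apply: inA; apply/andP.
- have [dB|dB] := le_or_lt d (2/3); first by apply: inAB; apply/andP; lin.
  have n2 : n.+2%:R = 1 + n.+1%:R :> R by rewrite nat1r.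
  have n3 : n.+3%:R = 1 + n.+2%:R :> R by rewrite nat1r.
  have /andP[wc0 _] : 0 <= cpath n.+2 c <= n.+3%:R by apply: cpath_range; apply/andP.
  have /andP[_ wd1] : 0 <= cpath n.+2 d <= n.+3%:R by apply: cpath_range; apply/andP.
  have wc1 := cpathA_le n c0 cA.
  have wd0 := cpathC_ge1 n (ltW dB) d1.
  have [dn|dn] := le_or_lt (cpath n.+2 d) n.+2%:R.
    apply: (@crook_turn _ _ _ _ (1/3)) => //; first by left; split; lin.
    + by left; rewrite cpath13.
    + by move=> z /(@btw_itv _ 0 (1/3)) zb; apply: inA; [apply/andP|apply: zb; apply/andP; lin].
    + move=> z /(@btw_itv _ (1/3) 1) zb.
      have {zb}/andP[z0 z1] : 1/3 <= z <= 1 by apply: zb; apply/andP; lin.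
      have [zB|zB] := le_or_lt z (2/3); first by apply: inBC; apply/andP; lin.
      by apply: inC; apply/andP; lin.
  have [cn|cn] := le_or_lt 1 (cpath n.+2 c).
    apply: (@crook_turn _ _ _ _ (2/3)) => //; first by left; split; lin.
    + by right; rewrite cpath23.
    + move=> z /(@btw_itv _ 0 (2/3)) zb.
      have {zb}/andP[z0 z1] : 0 <= z <= 2/3 by apply: zb; apply/andP; lin.
      have [zB|zB] := le_or_lt z (1/3); first by apply: inA; apply/andP; lin.
      by apply: inAB; apply/andP; lin.
    + by move=> z /(@btw_itv _ (2/3) 1) zb; apply: inC; [apply: zb; apply/andP; lin|apply/andP; lin].
  exists (1/3), (2/3); rewrite cpath13 cpath23 !ler_norml; split.
  - by left; split; lin.
  - by left; split; lin.
  - by apply/andP; lin.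
  - by apply/andP; lin.
- have [cB|cB] := le_or_lt c (2/3); have [dB|dB] := le_or_lt d (2/3); try lin.
  + by apply: inB; apply/andP; lin.
  + by apply: inBC; apply/andP; lin.
  + by apply: inC; apply/andP; lin.
Qed.

(** Each recursion step multiplies slopes by 3, and an interval meeting two
thirds keeps at least half of its length in one of them; this gains a factor
3/2 over two indices, which is what the bound asks for. *)
Lemma cpath_spread n p q : 0 <= p -> p <= q -> q <= 1 ->
  spread (cpath n) p q ((n%:R + 4) / 6 * (q - p)).
Proof.
elim/nat_ind2: n p q => [||n IH1 IH2] p q p0 pq q1.
- by apply: spread_ends => //; rewrite !cpathE0 ger0_norm; lin.
- by apply: spread_ends => //; rewrite !cpathE1 ger0_norm; lin.
have n1 : n.+1%:R = 1 + n%:R :> R by rewrite nat1r.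
have n2 : n.+2%:R = 1 + n.+1%:R :> R by rewrite nat1r.
have n0 : 0 <= n%:R :> R by rewrite ler0n.
set K := (n%:R + 4) / 6 in IH1.
have K0 : 0 < K by rewrite /K; lin.
have inA x y : 0 <= x -> x <= y -> y <= 1/3 -> spread (cpath n.+2) x y (3 * K * (y - x)).
  move=> x0 xy y1; rewrite -[_ * (y - x)]mul1r -[X in X * _](@normr1 R).
  apply: (@spread_affine _ (cpath n.+1) _ 1 3 0 0) => //.
    by move=> z /andP[_ z1]; rewrite cpathA ?mul1r ?addr0 //; lin.
  apply: spread_le (IH2 (3 * x) (3 * y) _ _ _); rewrite ?addr0 //; try lin.
  rewrite /K n1; nra.
have inB x y : 1/3 <= x -> x <= y -> y <= 2/3 -> spread (cpath n.+2) x y (3 * K * (y - x)).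
  move=> x0 xy y1; rewrite -[_ * (y - x)]mul1r -[X in X * _](@normr1 R) -normrN.
  apply: (@spread_affine _ (cpath n) _ (-1) 3 (-1) n.+2%:R) => //.
    by move=> z /andP[z0 z1]; rewrite cpathB ?mulN1r 1?addrC //; lin.
  apply: spread_le (IH1 (3 * x - 1) (3 * y - 1) _ _ _); try lin.
have inC x y : 2/3 <= x -> x <= y -> y <= 1 -> spread (cpath n.+2) x y (3 * K * (y - x)).
  move=> x0 xy y1; rewrite -[_ * (y - x)]mul1r -[X in X * _](@normr1 R).
  apply: (@spread_affine _ (cpath n.+1) _ 1 3 (-2) 1) => //.
    by move=> z /andP[z0 z1]; rewrite cpathC ?mul1r 1?addrC //; lin.
  apply: spread_le (IH2 (3 * x - 2) (3 * y - 2) _ _ _); try lin.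
  rewrite /K n1; nra.
have half u v : 0 <= v -> v <= 2 * u -> (n.+2%:R + 4) / 6 * v <= 3 * K * u.
  by move=> v0 uv; rewrite /K n2 n1; nra.
have two e : p <= e -> e <= q ->
    spread (cpath n.+2) p e (3 * K * (e - p)) ->
    spread (cpath n.+2) e q (3 * K * (q - e)) ->
    spread (cpath n.+2) p q ((n.+2%:R + 4) / 6 * (q - p)).
  move=> pe eq s1 s2; have [pq2|pq2] := le_or_lt (q - p) (2 * (e - p)).
    by apply: spread_le s1 => //; apply: half => //; lin.
  by apply: spread_le s2 => //; apply: half => //; lin.
have one : spread (cpath n.+2) p q (3 * K * (q - p)) ->
    spread (cpath n.+2) p q ((n.+2%:R + 4) / 6 * (q - p)).
  by move=> s1; apply: spread_le s1 => //; apply: half => //; lin.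
have [qA|qA] := le_or_lt q (1/3); first exact/one/inA.
have [pC|pC] := le_or_lt (2/3) p; first exact/one/inC.
have [pA|pA] := le_or_lt p (1/3).
  have [qB|qB] := le_or_lt q (2/3).
    by apply: (two (1/3)); [lin|lin|apply: inA; lin|apply: inB; lin].
  exists (1/3), (2/3); rewrite cpath13 cpath23; split; try by apply/andP; lin.
  by rewrite n2 n1 ger0_norm; [nra|lin].
have [qB|qB] := le_or_lt q (2/3); first by apply: one; apply: inB; lin.
by apply: (two (2/3)); [lin|lin|apply: inB; lin|apply: inC; lin].
Qed.

End CrookedPaths.

(** * The periodic zigzag *)

Section Zigzag.
Variables (R : realType) (m : nat).
Implicit Types (h : R -> R) (a b c d x y t L : R).

(** One period: a crooked ascent from 0 to [m.+2] followed by a crooked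
descent back to 1. *)
Definition zig_period t :=
  if t <= 1/2 then cpath m.+1 (2 * t) else m.+2%:R - cpath m (2 * t - 1).

Definition zig t := (Num.floor t)%:~R + zig_period (t - (Num.floor t)%:~R).

Lemma zig1B t : 1/2 <= t -> zig_period t = m.+2%:R - cpath m (2 * t - 1).
Proof.
move=> t2; rewrite /zig_period; case: (leP t (1/2)) => // t1; have -> : t = 1/2 by lin.
have -> : 2 * (1/2) = 1 :> R by field.
by rewrite subrr cpath0 cpath1 subr0.
Qed.

Lemma zig1_0 : zig_period 0 = 0.
Proof. by rewrite /zig_period ifT ?mulr0 ?cpath0 //; lin. Qed.

Lemma zig1_1 : zig_period 1 = 1.
Proof.
rewrite zig1B; last by lin.
have -> : 2 * 1 - 1 = 1 :> R by ring.
by rewrite cpath1 -[m.+2]addn1 natrD addrAC subrr add0r.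
Qed.

Lemma zig1_half : zig_period (1/2) = m.+2%:R.
Proof.
rewrite zig1B //; have -> : 2 * (1/2) - 1 = 0 :> R by field.
by rewrite cpath0 subr0.
Qed.

Lemma zig_shift k t : zig (t + k%:~R) = zig t + k%:~R.
Proof.
rewrite /zig floorDrz ?intr_int // intrKfloor rmorphD /= -addrA [RHS]addrAC -addrA.
by congr (_ + (_ + zig_period _)); ring.
Qed.

Lemma zigE k t : k%:~R <= t <= k%:~R + 1 -> zig t = k%:~R + zig_period (t - k%:~R).
Proof.
move=> /andP[t0 t1]; have [tk|tk] := ltP t (k%:~R + 1).
  by rewrite /zig (@floor_def _ t k) // t0 intrD.
have -> : t = 1 + k%:~R by lin.
rewrite zig_shift addrK zig1_1 addrC; congr (_ + _).
by rewrite /zig floor1 subrr zig1_0 addr0.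
Qed.

Lemma zigE0 t : 0 <= t <= 1 -> zig t = zig_period t.
Proof. by move=> /andP[t0 t1]; rewrite (@zigE 0) ?add0r ?subr0 // t0. Qed.

Lemma zig_int k : zig k%:~R = k%:~R.
Proof. by rewrite (@zigE k) ?subrr ?zig1_0 ?addr0 // lexx; lin. Qed.

Lemma zig_half k : zig (k%:~R + 1/2) = k%:~R + m.+2%:R.
Proof.
rewrite (@zigE k); last by apply/andP; lin.
by rewrite addrAC subrr add0r zig1_half.
Qed.

Lemma zig1_lip : exists2 L, 1 <= L & lip L zig_period.
Proof.
have [L1 L10 h1] := cpath_lip R m; have [L2 L20 h2] := cpath_lip R m.+1.
exists (2 * (L1 + L2) + 1); first by lin.
have lA : lip (2 * (L1 + L2) + 1) (fun t => cpath m.+1 (2 * t)).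
  apply: (@lip_le _ (`|1| * L2 * `|2|)); first by rewrite !ger0_norm; lin.
  by move=> x y; have := lip_affine 1 2 0 0 h2 x y; rewrite !mul1r !addr0.
have lB : lip (2 * (L1 + L2) + 1) (fun t => m.+2%:R - cpath m (2 * t - 1)).
  apply: (@lip_le _ (`|-1| * L1 * `|2|)).
    by rewrite normrN !ger0_norm; lin.
  move=> x y; have := lip_affine (-1) 2 (-1) m.+2%:R h1 x y.
  by rewrite !mulN1r ![- _ + m.+2%:R]addrC.
apply: lip_glue => //.
have -> : 2 * (1/2) = 1 :> R by field.
by rewrite subrr cpath0 cpath1 subr0.
Qed.

Lemma zig_lip : exists2 L, 1 <= L & lip L zig.
Proof.
have [L L1 hL] := zig1_lip; exists L => //.
have same k x y : k%:~R <= x <= k%:~R + 1 -> k%:~R <= y <= k%:~R + 1 ->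
    `|zig x - zig y| <= L * `|x - y|.
  move=> xk yk; rewrite (zigE xk) (zigE yk).
  have -> : forall u v w : R, u + v - (u + w) = v - w by move=> *; ring.
  apply: (le_trans (hL _ _)).
  by have -> : x - k%:~R - (y - k%:~R) = x - y by ring.
move=> x y; wlog xy : x y / x <= y.
  move=> H; have [/H //|/ltW /H] := le_or_lt x y.
  by rewrite distrC (distrC x).
have /andP[x0 x1] := floor_itv x; have /andP[y0 y1] := floor_itv y.
rewrite !intrD in x1 y1.
have [e|ne] := eqVneq (Num.floor x) (Num.floor y).
  by rewrite -e in y0 y1; apply: (same (Num.floor x)); apply/andP; lin.
set k := Num.floor x in x0 x1 ne *; set l := Num.floor y in y0 y1 ne *.
have kl : k%:~R + 1 <= l%:~R :> R.
  have : (k < l) by rewrite lt_neqAle ne /=; exact: le_floor.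
  by rewrite -lezD1 -(ler_int R) intrD.
have e1 : `|zig x - zig (k + 1)%:~R| <= L * `|x - (k + 1)%:~R|.
  by apply: (same k); rewrite ?intrD; apply/andP; lin.
have e2 : `|zig y - zig l%:~R| <= L * `|y - l%:~R|.
  by apply: (same l); apply/andP; lin.
rewrite !zig_int intrD in e1 e2.
rewrite (ler0_norm (_ : x - (k%:~R + 1) <= 0)) in e1; last by lin.
rewrite (ger0_norm (_ : 0 <= y - l%:~R)) in e2; last by lin.
rewrite (ler0_norm (_ : x - y <= 0)); last by lin.
have : 0 <= (L - 1) * (l%:~R - (k%:~R + 1)) by apply: mulr_ge0; lin.
move: e1 e2; rewrite !ler_norml => /andP[? ?] /andP[? ?] ?.
by apply/andP; split; lin.
Qed.

Lemma zig_cont : continuous zig.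
Proof. by have [L _] := zig_lip; exact: lip_continuous. Qed.

Lemma zig1A_range t : 0 <= t <= 1/2 -> 0 <= zig_period t <= m.+2%:R.
Proof.
move=> /andP[t0 t1]; rewrite /zig_period t1.
by apply: cpath_range; apply/andP; lin.
Qed.

Lemma zig1B_range t : 1/2 <= t <= 1 -> 1 <= zig_period t <= m.+2%:R.
Proof.
move=> /andP[t0 t1]; rewrite zig1B //.
have m2 : m.+2%:R = 1 + m.+1%:R :> R by rewrite nat1r.
have /andP[? ?] : 0 <= cpath m (2 * t - 1) <= m.+1%:R.
  by apply: cpath_range; apply/andP; lin.
by apply/andP; lin.
Qed.

Lemma zig1_range t : 0 <= t <= 1 -> 0 <= zig_period t <= m.+2%:R.
Proof.
move=> /andP[t0 t1]; have [th|th] := le_or_lt t (1/2).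
  by apply: zig1A_range; apply/andP.
have /andP[? ?] : 1 <= zig_period t <= m.+2%:R by apply: zig1B_range; apply/andP; lin.
by apply/andP; lin.
Qed.

Lemma zig_floor_range t :
  (Num.floor t)%:~R <= zig t <= (Num.floor t)%:~R + m.+2%:R.
Proof.
have /andP[t0 t1] := floor_itv t; rewrite intrD in t1.
have /andP[? ?] : 0 <= zig_period (t - (Num.floor t)%:~R) <= m.+2%:R.
  by apply: zig1_range; apply/andP; lin.
by rewrite /zig; apply/andP; lin.
Qed.

Lemma zig_ge k t : k%:~R <= t -> k%:~R <= zig t.
Proof.
move=> kt; have /andP[+ _] := zig_floor_range t; apply: le_trans.
by rewrite ler_int floor_ge_int.
Qed.

Lemma zig_near t : -1 <= zig t - t <= m.+2%:R.
Proof.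
have /andP[t0 t1] := floor_itv t; rewrite intrD in t1.
by have /andP[? ?] := zig_floor_range t; apply/andP; lin.
Qed.

Lemma zig_inA x y : 0 <= x <= 1/2 -> 0 <= y <= 1/2 -> crook zig 1 x y.
Proof.
move=> xb yb; apply: (@crook_affine _ (cpath m.+1) _ 1 2 0 0 1) => //.
- by rewrite normr1 mulr1.
- move=> z /(btw_itv xb yb) /andP[z0 z1].
  by rewrite zigE0 /zig_period ?z1 ?mul1r ?addr0 //; apply/andP; lin.
- by case/andP: xb => ? ?; case/andP: yb => ? ?; apply: cpath_crook; apply/andP; lin.
Qed.

Lemma zig_inB x y : 1/2 <= x <= 1 -> 1/2 <= y <= 1 -> crook zig 1 x y.
Proof.
move=> xb yb; apply: (@crook_affine _ (cpath m) _ (-1) 2 (-1) m.+2%:R 1) => //.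
- by rewrite normrN normr1 mulr1.
- move=> z /(btw_itv xb yb) /andP[z0 z1].
  by rewrite zigE0 ?zig1B ?mulN1r 1?addrC //; apply/andP; lin.
- by case/andP: xb => ? ?; case/andP: yb => ? ?; apply: cpath_crook; apply/andP; lin.
Qed.

Lemma zig_crook_shift k dl x y :
  crook zig dl (x + k%:~R) (y + k%:~R) -> crook zig dl x y.
Proof.
move=> H; apply: (@crook_affine _ zig _ 1 1 k%:~R (- k%:~R) dl) => //.
- by rewrite normr1 mul1r.
- by move=> z _; rewrite !mul1r zig_shift addrK.
- by rewrite !mul1r.
Qed.

(** Induction on the number of periods. As for [cpath_crook], one of the
turning points between [x] and [y] is extremal, except when [x] is in the
first ascent with a value below 1 and [y] is higher than the top of this
ascent. As the two values differ by at most the height of an ascent, the first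
top and the next bottom are then within 1 of them. *)
Lemma zig_crook_nat N x y : 0 <= x -> x <= y -> y <= N%:R ->
  `|zig x - zig y| <= m.+2%:R -> crook zig 1 x y.
Proof.
have M0 : 0 < m.+2%:R :> R by rewrite ltr0n.
elim: N x y => [|N IH] c d c0 cd dN cdm.
  by apply: zig_inA; apply/andP; lin.
rewrite -nat1r in dN.
have z1 : zig 1 = 1 by exact: (zig_int 1).
have zh : zig (1/2) = m.+2%:R by rewrite -[1/2]add0r (zig_half 0) add0r.
have late x y : 1 <= x -> x <= y -> y <= 1 + N%:R ->
    `|zig x - zig y| <= m.+2%:R -> crook zig 1 x y.
  move=> x1 xy yN H; apply: (@zig_crook_shift (-1)).
  by apply: IH; rewrite ?zig_shift ?rmorphN /= ?mulr1z; [lin|lin|lin|];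
    have -> : forall u v : R, u + -1 - (v + -1) = u - v by move=> *; ring.
have [c1|c1] := le_or_lt 1 c; first exact: late.
have fromB x y : 1/2 <= x -> x <= 1 -> x <= y -> y <= 1 + N%:R ->
    `|zig x - zig y| <= m.+2%:R -> crook zig 1 x y.
  move=> xB x1 xy yN H; have [y1|/ltW y1] := le_or_lt y 1.
    by apply: zig_inB; apply/andP; lin.
  apply: (@crook_turn_level _ _ _ _ 1); first exact: zig_cont.
  - by left.
  - right; rewrite z1; split; last exact: (@zig_ge 1).
    rewrite zigE0; last by apply/andP; lin.
    by have /andP[] : 1 <= zig_period x <= m.+2%:R by apply: zig1B_range; apply/andP.
  - move=> z /(@btw_itv _ (1/2) 1) zb _.
    by apply: zig_inB; [apply/andP|apply: zb; apply/andP; lin].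
  - move=> z /(@btw_itv _ 1 y) zb hz.
    have {zb}/andP[z0 zy] : 1 <= z <= y by apply: zb; apply/andP; lin.
    by apply: late => //; rewrite hz.
have fromB' x y : 1/2 <= x -> x <= y -> y <= 1 + N%:R ->
    `|zig x - zig y| <= m.+2%:R -> crook zig 1 x y.
  move=> xB xy yN H; have [x1|/ltW x1] := le_or_lt x 1; first exact: fromB.
  exact: late.
have [cA|/ltW cB] := le_or_lt c (1/2); last exact: fromB'.
have [dA|/ltW dB] := le_or_lt d (1/2); first by apply: zig_inA; apply/andP; lin.
have cr : 0 <= zig c <= m.+2%:R.
  by rewrite zigE0; [apply: zig1A_range; apply/andP|apply/andP; lin].
have /andP[cr0 cr1] := cr.
have leftA z : btw c (1/2) z -> crook zig 1 c z.
  move=> /(@btw_itv _ 0 (1/2)) zb.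
  by apply: zig_inA; [apply/andP|apply: zb; apply/andP; lin].
have [dH|dH] := le_or_lt (zig d) m.+2%:R.
  apply: (@crook_turn_level _ _ _ _ (1/2)); first exact: zig_cont.
  - by left.
  - by left; rewrite zh.
  - by move=> z /leftA.
  - move=> z /(@btw_itv _ (1/2) d) zb hz.
    have {zb}/andP[z0 zd] : 1/2 <= z <= d by apply: zb; apply/andP; lin.
    by apply: fromB'; rewrite ?hz.
have d1 : 1 <= d.
  rewrite leNgt; apply/negP => d1.
  have /andP[] : 0 <= zig d <= m.+2%:R; last by lin.
  by rewrite zigE0; [apply: zig1_range; apply/andP; lin|apply/andP; lin].
have [a1|a1] := le_or_lt 1 (zig c).
  apply: (@crook_turn_level _ _ _ _ 1); first exact: zig_cont.
  - by left; split; lin.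
  - by right; rewrite z1; split => //; exact: (@zig_ge 1).
  - move=> z /(@btw_itv _ c 1) zb hz.
    have {zb}/andP[z0 zd] : c <= z <= 1 by apply: zb; apply/andP; lin.
    exfalso; have /andP[] : 0 <= zig z <= m.+2%:R; last by rewrite hz; lin.
    by rewrite zigE0; [apply: zig1_range; apply/andP; lin|apply/andP; lin].
  - move=> z /(@btw_itv _ 1 d) zb hz.
    have {zb}/andP[z0 zd] : 1 <= z <= d by apply: zb; apply/andP; lin.
    by apply: late => //; rewrite hz.
exists (1/2), 1; rewrite z1 zh; move: cdm; rewrite !ler_norml => /andP[? ?]; split.
- by left.
- by left; split; lin.
- by apply/andP; lin.
- by apply/andP; lin.
Qed.

Lemma zig_crook x y : 0 <= x -> 0 <= y ->
  `|zig x - zig y| <= m.+2%:R -> crook zig 1 x y.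
Proof.
wlog xy : x y / x <= y.
  move=> H x0 y0; have [/H|/ltW /H] := le_or_lt x y; first exact.
  by rewrite distrC => h h1; apply/crook_sym/h.
move=> x0 y0; apply: (@zig_crook_nat (Num.bound y)) => //.
by apply/ltW/archi_boundP.
Qed.

Lemma spread_zig_shift k p q l :
  spread zig (p + k%:~R) (q + k%:~R) l -> spread zig p q l.
Proof.
move=> H; rewrite -[l]mul1r -[X in X * _](@normr1 R).
apply: (@spread_affine _ zig _ 1 1 k%:~R (- k%:~R)) => //.
  by move=> z _; rewrite !mul1r zig_shift addrK.
by rewrite !mul1r.
Qed.

(** An interval of length at most 2 either contains a whole ascent or descent,
or has half of its length inside one of them. *)
Lemma zig_spread_small p q : 20 <= m%:R :> R -> p <= q -> q <= p + 2 ->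
  spread zig p q (4 * (q - p)).
Proof.
move=> m20; have m1 : m.+1%:R = 1 + m%:R :> R by rewrite nat1r.
have m2 : m.+2%:R = 1 + m.+1%:R :> R by rewrite nat1r.
have inA x y : 0 <= x -> x <= y -> y <= 1/2 -> spread zig x y (8 * (y - x)).
  move=> x0 xy y1; rewrite -[_ * (y - x)]mul1r -[X in X * _](@normr1 R).
  apply: (@spread_affine _ (cpath m.+1) _ 1 2 0 0) => //.
    move=> z /andP[z0 z1]; rewrite zigE0; last by apply/andP; lin.
    by rewrite /zig_period ifT ?mul1r ?addr0 //; lin.
  apply: (spread_le _ _ _ (@cpath_spread _ m.+1 (2 * x) (2 * y) _ _ _));
    rewrite ?addr0 //; try lin.
  by rewrite m1; nra.
have inB x y : 1/2 <= x -> x <= y -> y <= 1 -> spread zig x y (8 * (y - x)).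
  move=> x0 xy y1; rewrite -[_ * (y - x)]mul1r -[X in X * _](@normr1 R) -normrN.
  apply: (@spread_affine _ (cpath m) _ (-1) 2 (-1) m.+2%:R) => //.
    move=> z /andP[z0 z1]; rewrite zigE0; last by apply/andP; lin.
    by rewrite zig1B ?mulN1r 1?addrC //; lin.
  apply: (spread_le _ _ _ (@cpath_spread _ m (2 * x - 1) (2 * y - 1) _ _ _)); try lin.
  by nra.
have inC x y : 1 <= x -> x <= y -> y <= 3/2 -> spread zig x y (8 * (y - x)).
  move=> x0 xy y1; apply: (@spread_zig_shift (-1)).
  rewrite rmorphN /= mulr1z.
  have -> : 8 * (y - x) = 8 * ((y + -1) - (x + -1)) by ring.
  by apply: inA; lin.
have z1 : zig 1 = 1 by exact: (zig_int 1).
have zh : zig (1/2) = m.+2%:R by rewrite -[1/2]add0r (zig_half 0) add0r.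
have zh3 : zig (3/2) = 1 + m.+2%:R.
  by rewrite -(zig_half 1); congr zig; field.
have two x e y : x <= e -> e <= y ->
    spread zig x e (8 * (e - x)) -> spread zig e y (8 * (y - e)) ->
    spread zig x y (4 * (y - x)).
  move=> xe ey s1 s2; have [xy2|xy2] := le_or_lt (y - x) (2 * (e - x)).
    by apply: spread_le s1; lin.
  by apply: spread_le s2; lin.
wlog p01 : p q / 0 <= p < 1.
  move=> H pq pq2; apply: (@spread_zig_shift (- Num.floor p)).
  rewrite rmorphN /=.
  have -> : 4 * (q - p) = 4 * (q - (Num.floor p)%:~R - (p - (Num.floor p)%:~R)) by ring.
  by apply: H; try lin; have := floor_itv p; rewrite intrD => /andP[? ?]; apply/andP; lin.
case/andP: p01 => p0 p1 pq pq2.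
have [pA|pB] := le_or_lt p (1/2).
  have [qA|qA] := le_or_lt q (1/2).
    by apply: (spread_le _ _ _ (inA p q _ _ _)); lin.
  have [qB|qB] := le_or_lt q 1.
    by apply: (two _ (1/2)); [lin|lin|apply: inA; lin|apply: inB; lin].
  exists (1/2), 1; rewrite z1 zh; split; try by apply/andP; lin.
  by rewrite ger0_norm; lin.
have [qB|qB] := le_or_lt q 1.
  by apply: (spread_le _ _ _ (inB p q _ _ _)); lin.
have [qC|qC] := le_or_lt q (3/2).
  by apply: (two _ 1); [lin|lin|apply: inB; lin|apply: inC; lin].
exists (3/2), 1; rewrite z1 zh3; split; try by apply/andP; lin.
by rewrite ger0_norm; lin.
Qed.

(** Subtracting 1 centres the oscillation: the values taken over a period then
overflow the period on both sides. *)
Lemma zig_cover p q : 3 <= m%:R :> R -> p + 2 <= q ->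
  exists x y, [/\ p <= x <= q, p <= y <= q, zig x - 1 <= p & q <= zig y - 1].
Proof.
move=> m3 pq; have m1 : m.+1%:R = 1 + m%:R :> R by rewrite nat1r.
have m2 : m.+2%:R = 1 + m.+1%:R :> R by rewrite nat1r.
have /andP[p0 p1] := floor_itv p; have /andP[q0 q1] := floor_itv q.
rewrite !intrD in p1 q1.
exists (Num.floor p + 1)%:~R, ((Num.floor q - 1)%:~R + 1/2).
rewrite zig_int zig_half !intrD rmorphN /= mulr1z.
by split; try apply/andP; lin.
Qed.

Lemma zig_spread_large p q : 3 <= m%:R :> R -> p + 2 <= q -> spread zig p q (m.+2%:R).
Proof.
move=> m3 pq.
have /andP[p0 p1] := floor_itv p; rewrite intrD in p1.
exists ((Num.floor p + 1)%:~R + 1/2), (Num.floor p + 1)%:~R.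
rewrite zig_int zig_half intrD; split; try by apply/andP; lin.
by rewrite addrAC subrr add0r ger0_norm // ler0n.
Qed.

(** Shift [y] by an integer into the interval: [zig] changes by exactly that
integer. *)
Lemma zig_transl p q x y : p + 2 <= q -> p <= x <= q ->
  exists x', p <= x' <= q /\ `|zig y - zig x'| <= `|y - x| + 2.
Proof.
have subK (u v : R) : u - (u + v) = - v by ring.
move=> pq /andP[xp xq].
have [yp|yp] := le_or_lt p y; have [yq|yq] := le_or_lt y q.
- exists y; rewrite yp yq; split => //; rewrite subrr normr0.
  by have := normr_ge0 (y - x); lin.
- pose k := Num.floor (y - q) + 1.
  have /andP[k0 k1] := floor_itv (y - q); rewrite intrD in k1.
  exists (y + (- k)%:~R); rewrite zig_shift subK rmorphN /= /k intrD.
  split; first by apply/andP; lin.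
  by rewrite opprK !ger0_norm; lin.
- pose k := Num.floor (p - y) + 1.
  have /andP[k0 k1] := floor_itv (p - y); rewrite intrD in k1.
  exists (y + k%:~R); rewrite zig_shift subK /k intrD.
  split; first by apply/andP; lin.
  by rewrite normrN ger0_norm ?ler0_norm; lin.
- by lin.
Qed.

End Zigzag.

(** * Perturbations of the identity with small folds *)

Section Fold.
Variable R : realType.
Implicit Types (h : R -> R) (c d p q x y l : R).

(** Used to replace [c] or [d] by a point where [h] takes the opposite value. *)
Lemma crook_levels h dl c d x y : btw c d x -> btw x d y ->
  `|h x| = `|h c| -> `|h y| = `|h d| -> crook h dl x y ->
  crook (fun t => `|h t|) dl c d.
Proof.
move=> cdx xdy hx hy [c' [d' [H1 H2 H3 H4]]]; exists c', d'; split.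
- exact: btw_subr cdx (btw_sub xdy H1).
- exact: btw_sub (btw_mono xdy H1) H2.
- by rewrite -hy; apply: le_trans H3; exact: ler_dist_dist.
- by rewrite -hx; apply: le_trans H4; exact: ler_dist_dist.
Qed.

(** Folding the values at 0 does not destroy crookedness. When [h c] and [h d]
have opposite signs, the one with the smaller absolute value has its opposite
between [h c] and [h d], and this opposite value is attained between [c] and
[d]. *)
Lemma crook_abs h dl e c d : continuous h ->
  (forall x y, btw c d x -> btw c d y -> `|h x - h y| <= e -> crook h dl x y) ->
  `|(`|h c| - `|h d|)| <= e -> crook (fun t => `|h t|) dl c d.
Proof.
move=> hc H He.
have cc := btwl c d; have dd := btwr c d.
have [c0|c0] := le_or_lt 0 (h c); have [d0|d0] := le_or_lt 0 (h d);
  move: (He); rewrite ?(ger0_norm c0) ?(ltr0_norm c0) ?(ger0_norm d0) ?(ltr0_norm d0) => Hcd.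
- by apply: (crook_levels cc dd) => //; exact: H.
- have [cd|cd] := le_or_lt (h c) (- h d).
    have [x [cdx hx]] : exists x, btw c d x /\ h x = - h c.
      by apply: ivt => //; right; split; lin.
    apply: (crook_levels cdx (btwr x d)); rewrite ?hx ?normrN //.
    by apply: H => //; rewrite hx -normrN; have -> : - (- h c - h d) = h c - - h d by ring.
  have [y [cdy hy]] : exists y, btw c d y /\ h y = - h d.
    by apply: ivt => //; right; split; lin.
  apply: (crook_levels cc cdy); rewrite ?hy ?normrN //.
  by apply: H => //; rewrite hy.
- have [cd|cd] := le_or_lt (- h c) (h d).
    have [x [cdx hx]] : exists x, btw c d x /\ h x = - h c.
      by apply: ivt => //; left; split; lin.
    apply: (crook_levels cdx (btwr x d)); rewrite ?hx ?normrN //.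
    by apply: H => //; rewrite hx.
  have [y [cdy hy]] : exists y, btw c d y /\ h y = - h d.
    by apply: ivt => //; left; split; lin.
  apply: (crook_levels cc cdy); rewrite ?hy ?normrN //.
  by apply: H => //; rewrite hy -normrN; have -> : - (h c - - h d) = - h c - h d by ring.
- apply: (crook_levels cc dd) => //; apply: H => //.
  by rewrite -normrN; have -> : - (h c - h d) = - h c - - h d by ring.
Qed.

Lemma crook_opp h dl c d : crook h dl c d -> crook (fun t => 1 - h t) dl c d.
Proof.
have e u v : 1 - u - (1 - v) = v - u :> R by ring.
by move=> [c' [d' [? ? ? ?]]]; exists c', d'; split => //; rewrite e distrC.
Qed.

(** If the sign changes, one of the two values is at distance at least [l / 2]
from the zero in between. *)
Lemma spread_abs h p q l : continuous h -> spread h p q l ->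
  spread (fun t => `|h t|) p q (l / 2).
Proof.
move=> hc [x [y [xb yb H]]].
have L0 := normr_ge0 (h x - h y).
have zero : btw (h x) (h y) 0 -> spread (fun t => `|h t|) p q (l / 2).
  move=> /(ivt hc)[z [xyz hz]]; have zb := btw_itv xb yb xyz.
  have : l <= `|h x| + `|h y| by apply: (le_trans H); exact: ler_normB.
  have [hxy|hxy] := le_or_lt `|h x| `|h y| => Hl.
    by exists y, z; split => //=; rewrite hz normr0 subr0 normr_id; lin.
  by exists x, z; split => //=; rewrite hz normr0 subr0 normr_id; lin.
have [x0|x0] := le_or_lt 0 (h x); have [y0|y0] := le_or_lt 0 (h y).
- by exists x, y; split => //; rewrite (ger0_norm x0) (ger0_norm y0); lin.
- by apply: zero; right; split; lin.
- by apply: zero; left; split; lin.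
- exists x, y; split => //; rewrite (ltr0_norm x0) (ltr0_norm y0).
  rewrite -normrN; have -> : - (- h x - - h y) = h x - h y by ring.
  by lin.
Qed.

Lemma spread_opp h p q l : spread h p q l -> spread (fun t => 1 - h t) p q l.
Proof.
have e u v : 1 - u - (1 - v) = v - u :> R by ring.
by move=> [x [y [? ? H]]]; exists x, y; split => //; rewrite e distrC.
Qed.

Variables (m : nat) (ga : R).

Definition wave x := ga * (zig m (x / ga) - 1).

(** The two absolute values reflect [wave] at 0 and at 1. *)
Definition fold x := 1 - `|1 - `|wave x| |.

Hypotheses (m20 : 20 <= m%:R :> R) (ga0 : 0 < ga).
Let M : R := m.+2%:R.
Hypothesis gaM : ga * M <= 1/2.

Lemma M22 : 22 <= M.
Proof. move: (m20) (ga0) (gaM) => ? ? ?; by rewrite /M; lin. Qed.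

Lemma waveE x : wave x = ga * zig m (ga^-1 * x + 0) + (- ga).
Proof. move: (m20) (ga0) (gaM) => ? ? ?; by rewrite /wave addr0 [_ * x]mulrC mulrBr mulr1. Qed.

Lemma waveB x y : wave x - wave y = ga * (zig m (x / ga) - zig m (y / ga)).
Proof. move: (m20) (ga0) (gaM) => ? ? ?; by rewrite /wave; ring. Qed.

Lemma wave_lip : exists2 L, 1 <= L & lip L wave.
Proof.
move: (m20) (ga0) (gaM) => ? ? ?.
have [L L1 hL] := zig_lip R m; exists L => // x y.
have := lip_affine ga ga^-1 0 (- ga) hL x y.
rewrite -!waveE (gtr0_norm ga0) (gtr0_norm (_ : 0 < ga^-1)) ?invr_gt0 //.
by have -> : ga * L * ga^-1 = L by field; lin.
Qed.

Lemma fold_dist x y : `|fold x - fold y| <= `|wave x - wave y|.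
Proof.
move: (m20) (ga0) (gaM) => ? ? ?.
have e u v : 1 - u - (1 - v) = v - u :> R by ring.
rewrite /fold e; apply: (le_trans (ler_dist_dist _ _)).
by rewrite e; exact: ler_dist_dist.
Qed.

Lemma fold_lip : exists2 L, 1 <= L & lip L fold.
Proof.
move: (m20) (ga0) (gaM) => ? ? ?.
have [L L1 hL] := wave_lip; exists L => // x y.
exact: le_trans (fold_dist x y) (hL x y).
Qed.

Lemma fold_cont : continuous fold.
Proof. move: (m20) (ga0) (gaM) => ? ? ?; by have [L _] := fold_lip; exact: lip_continuous. Qed.

Lemma wave_cont : continuous wave.
Proof. move: (m20) (ga0) (gaM) => ? ? ?; by have [L _] := wave_lip; exact: lip_continuous. Qed.

Lemma wave_near x : - (2 * ga) <= wave x - x <= ga * M - ga.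
Proof.
move: (m20) (ga0) (gaM) => ? ? ?.
have /andP[z0 z1] := zig_near m (x / ga); rewrite -/M in z1.
have e : wave x - x = ga * (zig m (x / ga) - x / ga - 1) by rewrite /wave; field; lin.
rewrite e; apply/andP; split; nra.
Qed.

Lemma fold_id x : 0 <= wave x <= 1 -> fold x = wave x.
Proof.
move: (m20) (ga0) (gaM) => ? ? ?.
by move=> /andP[? ?]; rewrite /fold (ger0_norm (_ : 0 <= wave x)) ?ger0_norm; lin.
Qed.

Lemma fold_near x : 0 <= x <= 1 -> `|fold x - x| <= ga * M.
Proof.
move: (m20) (ga0) (gaM) => ? ? ?.
move=> /andP[x0 x1]; have /andP[w0 w1] := wave_near x; have M2 := M22.
have ? : 2 * ga <= ga * M by nra.
have H : `|wave x - x| <= ga * M by rewrite ler_norml; apply/andP; lin.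
apply: le_trans H.
have e : `|1 - `|wave x| | - `|1 - x| = - (fold x - x).
  by rewrite /fold (ger0_norm (_ : 0 <= 1 - x)); [ring|lin].
rewrite -normrN -e; apply: (le_trans (ler_dist_dist _ _)).
have -> : 1 - `|wave x| - (1 - x) = `|x| - `|wave x|.
  by rewrite (ger0_norm x0); ring.
by apply: (le_trans (ler_dist_dist _ _)); rewrite distrC.
Qed.

Lemma fold01 x : 0 <= x <= 1 -> 0 <= fold x <= 1.
Proof.
move: (m20) (ga0) (gaM) => ? ? ?.
move=> /andP[x0 x1]; have /andP[w0 w1] := wave_near x; have M2 := M22.
have ? : 2 * ga <= ga * M by nra.
have H : `|wave x| <= 2 by rewrite ler_norml; apply/andP; lin.
have H0 := normr_ge0 (wave x).
have H1 : `|1 - `|wave x| | <= 1 by rewrite ler_norml; apply/andP; lin.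
have H2 := normr_ge0 (1 - `|wave x|).
by rewrite /fold; apply/andP; lin.
Qed.

Lemma wave_crook x y : 0 <= x -> 0 <= y -> `|wave x - wave y| <= ga * M ->
  crook wave ga x y.
Proof.
move: (m20) (ga0) (gaM) => ? ? ?.
move=> x0 y0; rewrite waveB normrM (gtr0_norm ga0) ler_pM2l // => H.
apply: (@crook_affine _ (zig m) _ ga ga^-1 0 (- ga) 1); rewrite ?invr_gt0 //.
- by rewrite (gtr0_norm ga0) mulr1.
- by move=> z _; rewrite waveE.
rewrite !addr0 ![ga^-1 * _]mulrC; apply: zig_crook => //.
  by rewrite divr_ge0 // ltW.
by rewrite divr_ge0 // ltW.
Qed.

Lemma fold_crook c d : 0 <= c <= 1 -> 0 <= d <= 1 ->
  `|fold c - fold d| <= ga * M -> crook fold ga c d.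
Proof.
move: (m20) (ga0) (gaM) => ? ? ?.
move=> c01 d01 H.
have e u v : 1 - u - (1 - v) = v - u :> R by ring.
apply: (@crook_opp (fun t => `|1 - `|wave t| |)).
apply: (@crook_abs (fun t => 1 - `|wave t|) ga (ga * M)).
- move=> x; apply: (@cvgB _ R); first exact: cvg_cst.
  by apply: cvg_norm; exact: wave_cont.
- move=> x y cdx cdy; rewrite e distrC => Hxy.
  apply: crook_opp; apply: (@crook_abs wave ga (ga * M)) => //.
    exact: wave_cont.
  move=> x' y' /(btw_itv (btw_itv c01 d01 cdx) (btw_itv c01 d01 cdy))/andP[x0 _].
  move=> /(btw_itv (btw_itv c01 d01 cdx) (btw_itv c01 d01 cdy))/andP[y0 _].
  exact: wave_crook.
- by rewrite -normrN opprB -e; exact: H.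
Qed.

Lemma spread_wave p q l : spread (zig m) (p / ga) (q / ga) l ->
  spread wave p q (ga * l).
Proof.
move: (m20) (ga0) (gaM) => ? ? ?.
move=> H; rewrite -{1}(gtr0_norm ga0).
apply: (@spread_affine _ (zig m) _ ga ga^-1 0 (- ga)); rewrite ?invr_gt0 //.
- by move=> z _; rewrite waveE.
- by rewrite !addr0 ![ga^-1 * _]mulrC.
Qed.

Lemma spread_fold p q l : spread wave p q l -> spread fold p q (l / 4).
Proof.
move: (m20) (ga0) (gaM) => ? ? ?.
move=> H; have -> : l / 4 = l / 2 / 2 by field.
apply: (@spread_opp (fun t => `|1 - `|wave t| |)).
apply: (@spread_abs (fun t => 1 - `|wave t|)).
  move=> x; apply: (@cvgB _ R); first exact: cvg_cst.
  by apply: cvg_norm; exact: wave_cont.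
apply: (@spread_opp (fun t => `|wave t|)).
exact/spread_abs/H/wave_cont.
Qed.

Lemma divga2 p q : (p / ga + 2 <= q / ga) = (p + 2 * ga <= q).
Proof.
move: (m20) (ga0) (gaM) => ? ? ?.
rewrite -[X in X + _ <= _]divr1 -subr_ge0 -[RHS]subr_ge0.
have -> : q / ga - (p / ga / 1 + 2) = (q - (p + 2 * ga)) / ga by field; lin.
by rewrite pmulr_lge0 // invr_gt0.
Qed.

Lemma fold_spread_large p q : p + 2 * ga <= q -> spread fold p q (ga * M / 4).
Proof.
move: (m20) (ga0) (gaM) => ? ? ?.
by move=> pq; apply/spread_fold/spread_wave/zig_spread_large; rewrite ?divga2 //; lin.
Qed.

(** A long interval is covered by its own image under [wave], and reflections
fix [0, 1]; on a short one the slope of [wave] compensates the two factors 1/2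
lost by reflecting. *)
Lemma fold_expand p q : 0 <= p -> p <= q -> q <= 1 -> spread fold p q (q - p).
Proof.
move: (m20) (ga0) (gaM) => ? ? ?.
move=> p0 pq q1; have [pq2|pq2] := le_or_lt (p + 2 * ga) q; last first.
  have -> : q - p = ga * (4 * (q / ga - p / ga)) / 4 by field; lin.
  apply/spread_fold/spread_wave/zig_spread_small => //.
    by rewrite ler_pM2r // invr_gt0.
  rewrite -subr_ge0; have -> : p / ga + 2 - q / ga = (p + 2 * ga - q) / ga by field; lin.
  by rewrite pmulr_lge0 ?invr_gt0 //; lin.
have [||x [y [xb yb hx hy]]] := @zig_cover R m (p / ga) (q / ga); rewrite ?divga2 //; first by lin.
have scale z : p / ga <= z <= q / ga -> p <= ga * z <= q.
  by rewrite ler_pdivrMr // ler_pdivlMr // mulrC.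
have wE z : wave (ga * z) = ga * (zig m z - 1).
  by rewrite /wave; congr (_ * (zig m _ - 1)); field; lin.
have wx : wave (ga * x) <= p by rewrite wE mulrC -ler_pdivlMr.
have wy : q <= wave (ga * y) by rewrite wE mulrC -ler_pdivrMr.
have [x' [xx hx']] : exists x', btw (ga * x) (ga * y) x' /\ wave x' = p.
  by apply: ivt; [exact: wave_cont|left; split; lin].
have [y' [yy hy']] : exists y', btw (ga * x) (ga * y) y' /\ wave y' = q.
  by apply: ivt; [exact: wave_cont|left; split; lin].
exists y', x'; split.
- exact: btw_itv (scale _ xb) (scale _ yb) yy.
- exact: btw_itv (scale _ xb) (scale _ yb) xx.
- by rewrite !fold_id ?hx' ?hy' ?ger0_norm //; try (apply/andP; split); lin.
Qed.

Lemma fold_transl p q x y : p + 2 * ga <= q -> p <= x <= q ->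
  exists x', p <= x' <= q /\ `|fold y - fold x'| <= `|y - x| + 2 * ga.
Proof.
move: (m20) (ga0) (gaM) => ? ? ?.
move=> pq /andP[xp xq].
have [||x' [/andP[x'p x'q] H]] := @zig_transl R m (p / ga) (q / ga) (x / ga) (y / ga).
- by rewrite divga2.
- by rewrite !ler_pM2r ?invr_gt0 // xp.
rewrite ler_pdivrMr // in x'p; rewrite ler_pdivlMr // in x'q.
exists (x' * ga); split; first by apply/andP.
apply: (le_trans (fold_dist _ _)).
rewrite waveB normrM (gtr0_norm ga0) mulfK ?gt_eqF //.
have -> : `|y - x| + 2 * ga = ga * (`|y / ga - x / ga| + 2).
  by rewrite -mulrBl normrM (gtr0_norm (_ : 0 < ga^-1)) ?invr_gt0 //; field; lin.
by rewrite ler_pM2l.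
Qed.

(** If the images are more than the height of an ascent apart, they exceed it
by at most [(K + 1) * ga], because the points are close. Then replace [y] by a
point [z] between them whose image is exactly at that height from [fold x],
and use crookedness there. The last two bounds ensure that the pieces thus
found are long enough for [zig_transl]. *)
Lemma fold_local_crook K x y : 0 <= x <= 1 -> 0 <= y <= 1 -> 0 <= K ->
  `|x - y| <= K * ga -> 3 * ga <= `|fold x - fold y| ->
  exists x' y', [/\ btw x y x', btw x' y y',
    `|fold x' - fold y| <= (K + 2) * ga, `|fold y' - fold x| <= ga
    & 2 * ga <= `|fold x - fold x'| /\ 2 * ga <= `|fold y - fold y'| ].
Proof.
move: (m20) (ga0) (gaM) => ? ? ?.
move=> x01 y01 K0 xyK xy3; have M2 := M22.
have cont := fold_cont.
have up : `|fold x - fold y| <= ga * M + (K + 1) * ga.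
  apply: (le_trans (fold_dist _ _)).
  have -> : wave x - wave y = (wave x - x) - (wave y - y) + (x - y) by ring.
  have /andP[? ?] := wave_near x; have /andP[? ?] := wave_near y.
  move: xyK; rewrite !ler_norml => /andP[? ?]; apply/andP; lin.
have [z [xyz fz1 fz2 fz3]] : exists z, [/\ btw x y z,
    `|fold x - fold z| <= ga * M, 3 * ga <= `|fold x - fold z| &
    `|fold z - fold y| <= (K + 1) * ga].
  have [le|gt] := le_or_lt (`|fold x - fold y|) (ga * M).
    exists y; split => //; first exact: btwr.
    by rewrite subrr normr0 mulr_ge0 //; lin.
  have M0 : 0 <= ga * M by nra.
  have M3 : 3 * ga <= ga * M by nra.
  have [fxy|fxy] := le_or_lt (fold x) (fold y).
    move: up gt; rewrite ler0_norm; [|lin] => up gt.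
    have [z [xyz fz]] : exists z, btw x y z /\ fold z = fold x + ga * M.
      by apply: ivt => //; left; split; lin.
    exists z; split => //; rewrite fz ler0_norm; lin.
  move: up gt; rewrite gtr0_norm; [|lin] => up gt.
  have [z [xyz fz]] : exists z, btw x y z /\ fold z = fold x - ga * M.
    by apply: ivt => //; right; split; lin.
  exists z; split => //; rewrite fz ger0_norm; lin.
have z01 := btw_itv x01 y01 xyz.
have [x' [y' [H1 H2 H3 H4]]] := fold_crook x01 z01 fz1.
exists x', y'; split => //.
- exact: btw_sub H1.
- exact: btw_sub (btw_mono xyz H1) H2.
- have := ler_normD (fold x' - fold z) (fold z - fold y).
  by rewrite addrA subrK => h; lin.
split.
- have := ler_normD (fold x - fold x') (fold x' - fold z).
  by rewrite addrA subrK => h; lin.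
- have := ler_normD (fold x - fold y') (fold y' - fold y).
  by rewrite addrA subrK (distrC (fold y') (fold y)) (distrC (fold x) (fold y')) => h; lin.
Qed.

End Fold.

(** * Composing an expanding map with a perturbation makes an iterate crooked *)

(** What the rest of the construction uses of [fold]: [eps] bounds the
displacement and is the scale of crookedness, [ga] is the size of the folds. *)
Record folding (R : realType) (eps ga : R) (g : R -> R) : Prop := Folding {
  fo_lip : exists2 L, 1 <= L & lip L g;
  fo_unit : forall x, 0 <= x <= 1 -> 0 <= g x <= 1;
  fo_near : forall x, 0 <= x <= 1 -> `|g x - x| <= eps;
  fo_crook : forall c d, 0 <= c <= 1 -> 0 <= d <= 1 -> `|g c - g d| <= eps ->
    crook g ga c d;
  fo_expand : forall p q, 0 <= p -> p <= q -> q <= 1 -> spread g p q (q - p);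
  fo_large : forall p q, p + 2 * ga <= q -> spread g p q (eps / 4);
  fo_transl : forall p q x y, p + 2 * ga <= q -> p <= x <= q ->
    exists x', p <= x' <= q /\ `|g y - g x'| <= `|y - x| + 2 * ga;
  fo_local : forall K x y, 0 <= x <= 1 -> 0 <= y <= 1 -> 0 <= K ->
    `|x - y| <= K * ga -> 3 * ga <= `|g x - g y| ->
    exists x' y', [/\ btw x y x', btw x' y y',
      `|g x' - g y| <= (K + 2) * ga, `|g y' - g x| <= ga
      & 2 * ga <= `|g x - g x'| /\ 2 * ga <= `|g y - g y'| ] }.

Definition unit_map (R : realType) (h : R -> R) := forall x, 0 <= h x <= 1.

(** Intervals are stretched by [s] until they cover [0, 1]: a map into [0, 1]
whose values differ by 1 takes both values 0 and 1. *)
Definition expand (R : realType) (h : R -> R) (s : R) := forall p q,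
  0 <= p -> p <= q -> q <= 1 -> spread h p q (Num.min 1 (s * (q - p))).

Section Expand.
Variable R : realType.
Implicit Types (h f g F : R -> R) (c d p q x y l s : R).

(** [ga] is [eps] divided by the height of an ascent, so it is small when the
ascents are high. *)
Lemma folding_exists (eps gmax : R) : 0 < eps -> eps <= 1/2 -> 0 < gmax ->
  exists g ga, [/\ 0 < ga, ga <= gmax, 22 * ga <= eps & folding eps ga g].
Proof.
move=> e0 e1 gm0; pose N := Num.bound (eps / gmax).
have N0 : eps / gmax < N%:R by apply: archi_boundP; rewrite divr_ge0 // ltW.
pose m := (20 + N)%N.
have m20 : 20 <= m%:R :> R by rewrite /m natrD ler_wpDr.
have mN : N%:R <= m%:R :> R by rewrite ler_nat leq_addl.
pose M : R := m.+2%:R.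
have M2 : 22 <= M by rewrite /M; lin.
have MN : m%:R <= M by rewrite /M; lin.
have M0 : 0 < M by lin.
have ga0 : 0 < eps / M by rewrite divr_gt0.
have gaM : eps / M * M = eps by field; lin.
have gaM' : eps / M * m.+2%:R <= 1/2 by rewrite gaM.
exists (fold m (eps / M)), (eps / M); split => //.
- rewrite ler_pdivrMr // mulrC -ler_pdivrMr //; lin.
- by rewrite mulrA ler_pdivrMr //; nra.
rewrite -{1}gaM; split.
- exact: fold_lip.
- by move=> x; exact: fold01.
- by move=> x; exact: fold_near.
- by move=> c d; exact: fold_crook.
- by move=> p q; exact: fold_expand.
- by move=> p q; exact: fold_spread_large.
- by move=> p q x y; exact: fold_transl.
- by move=> K x y; exact: fold_local_crook.
Qed.

Lemma crook_comp h1 h2 dl c d : continuous h1 ->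
  crook h2 dl (h1 c) (h1 d) -> crook (h2 \o h1) dl c d.
Proof.
move=> hc [c1 [d1 [H1 H2 H3 H4]]].
have [c' [cc hc']] := ivt hc H1; rewrite -hc' in H2 H3.
have [d' [dd hd']] := ivt hc H2; rewrite -hd' in H4.
by exists c', d'.
Qed.

(** Two points where [h] is far apart can be chosen with their values on both
sides of a given value [h x]. *)
Lemma spread_hull h p q l x : spread h p q l -> p <= x <= q ->
  exists t1 t2, [/\ p <= t1 <= q, p <= t2 <= q, h t1 <= h x <= h t2
    & l <= h t2 - h t1].
Proof.
move=> [u [v [ub vb H]]] xb.
wlog uv : u v ub vb H / h u <= h v.
  move=> K; have [uv|/ltW uv] := le_or_lt (h u) (h v); first exact: (K u v).
  by apply: (K v u) => //; rewrite distrC.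
rewrite ler0_norm in H; last by lin.
have [xu|xu] := le_or_lt (h u) (h x); have [xv|xv] := le_or_lt (h x) (h v).
- by exists u, v; split => //; [rewrite xu|lin].
- by exists u, x; split => //; [rewrite xu lexx|lin].
- by exists x, v; split => //; [rewrite lexx|lin].
- by lin.
Qed.

Lemma spread_pull h1 h2 p q x y l : continuous h1 -> p <= x <= q -> p <= y <= q ->
  h1 x <= h1 y -> spread h2 (h1 x) (h1 y) l -> spread (h2 \o h1) p q l.
Proof.
move=> hc xb yb xy [u [v [/andP[u1 u2] /andP[v1 v2] H]]].
have [u' [uu hu]] : exists t, btw x y t /\ h1 t = u by apply: ivt => //; left.
have [v' [vv hv]] : exists t, btw x y t /\ h1 t = v by apply: ivt => //; left.
exists u', v'; split; [exact: btw_itv xb yb uu|exact: btw_itv xb yb vv|].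
by rewrite /= hu hv.
Qed.

(** Truncation by 1 is harmless because [s2] is at least 1. *)
Lemma expand_comp h1 h2 s1 s2 : continuous h1 -> unit_map h1 ->
  0 <= s1 -> 1 <= s2 -> expand h1 s1 -> expand h2 s2 ->
  expand (h2 \o h1) (s2 * s1).
Proof.
move=> hc hu s10 s21 e1 e2 p q p0 pq q1.
have pp : p <= p <= q by rewrite lexx.
have [t1 [t2 [t1b t2b /andP[h1p h2p] H]]] := spread_hull (e1 p q p0 pq q1) pp.
have /andP[? _] := hu t1; have /andP[_ ?] := hu t2.
apply: (spread_pull hc t1b t2b); first exact: le_trans h2p.
apply: spread_le (e2 (h1 t1) (h1 t2) _ _ _) => //; last exact: le_trans h2p.
rewrite le_min ge_min lexx /= ge_min; apply/orP.
move: H; rewrite ge_min => /orP[H|H]; [left|right].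
  have : 0 <= (s2 - 1) * (h1 t2 - h1 t1 - 1) by apply: mulr_ge0; lin.
  by lin.
by rewrite -mulrA; apply: ler_wpM2l => //; lin.
Qed.

Lemma expand_id : expand (@id R) 1.
Proof.
move=> p q p0 pq q1; apply: spread_ends => //.
by rewrite mul1r ge_min ler_norm orbT.
Qed.

Lemma unit_iter F n x : unit_map F -> 0 <= x <= 1 -> 0 <= iter n F x <= 1.
Proof. by case: n => //= n; move=> uF _; exact: uF. Qed.

Lemma cont_iter F n : continuous F -> continuous (iter n F).
Proof.
move=> cF; elim: n => [|n IH] x; first exact: cvg_id.
by apply: (@continuous_comp _ _ _ (iter n F) F); [exact: IH|exact: cF].
Qed.

Lemma expand_iter F s n : continuous F -> unit_map F -> 1 <= s -> expand F s ->
  expand (iter n F) (s ^+ n).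
Proof.
move=> cF uF s1 eF; elim: n => [|n IH]; first exact: expand_id.
case: n IH => [|n] IH; first by rewrite expr1.
rewrite exprS; apply: (@expand_comp (iter n.+1 F) F) => //.
- exact: cont_iter.
- by move=> x; exact: uF.
- by rewrite exprn_ge0 //; lin.
Qed.

Lemma expand_cover h s p q t : continuous h ->
  (forall x, 0 <= x <= 1 -> 0 <= h x <= 1) -> expand h s ->
  0 <= p -> p <= q -> q <= 1 -> 1 <= s * (q - p) -> 0 <= t <= 1 ->
  exists x, p <= x <= q /\ h x = t.
Proof.
move=> hc hu he p0 pq q1 sl /andP[t0 t1].
have pp : p <= p <= q by rewrite lexx.
have [x [y [xb yb _]]] := spread_hull (he p q p0 pq q1) pp.
rewrite ge_min => /orP H.
have {H}H : 1 <= h y - h x by case: H; lin.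
have /andP[? _] : 0 <= h x <= 1 by apply: hu; case/andP: xb => *; apply/andP; lin.
have /andP[_ ?] : 0 <= h y <= 1 by apply: hu; case/andP: yb => *; apply/andP; lin.
have [z [zb hz]] : exists z, btw x y z /\ h z = t by apply: ivt => //; left; split; lin.
by exists z; split => //; exact: btw_itv xb yb zb.
Qed.

End Expand.

Section Perturb.
Variables (R : realType) (f g : R -> R) (L s eps ga : R).
Implicit Types (c d p q x y l r dl K : R) (n k j : nat).
Hypotheses (L1 : 1 <= L) (fL : lip L f) (fu : unit_map f) (s1 : 1 <= s)
  (fe : expand f s) (ga0 : 0 < ga) (gae : 22 * ga <= eps) (eps1 : eps <= 1/2)
  (Fo : folding eps ga g).

Let F := g \o f.

Lemma perturb_contf : continuous f. Proof. exact: lip_continuous fL. Qed.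

Lemma perturb_contg : continuous g.
Proof. by have [Lg _] := fo_lip Fo; exact: lip_continuous. Qed.

Lemma perturb_cont : continuous F.
Proof.
by move=> x; apply: (@continuous_comp _ _ _ f g);
  [exact: perturb_contf|exact: perturb_contg].
Qed.

Lemma perturb_unit : unit_map F.
Proof. by move=> x; apply: fo_unit Fo _ (fu x). Qed.

Lemma perturb_expand : expand F s.
Proof.
move: (s1) => s1'; rewrite -[s]mul1r; apply: expand_comp => //.
- exact: perturb_contf.
- by lin.
move=> p q p0 pq q1; apply: spread_le (fo_expand Fo p0 pq q1) => //.
by rewrite mul1r ge_min lexx orbT.
Qed.

(** Pointwise, [iter k F] may separate [x] and [y] at once. But the image by
[f] of the interval remains within [L * r] of [f y], and by [fo_transl] the
map [g] adds only [2 * ga] to this distance; the image intervals never get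
shorter than [2 * ga]. *)
Lemma perturb_push k p q x y r : 0 <= p -> q <= 1 -> p + 2 * ga <= q ->
  p <= x <= q -> 0 <= y <= 1 -> `|x - y| <= r ->
  exists x', p <= x' <= q /\
    `|iter k F x' - iter k F y| <= L ^+ k * (r + 2 * ga * k%:R).
Proof.
move: (s1) (ga0) (gae) (eps1) (L1) => s1' ga0' gae' eps1' L1'.
elim: k p q x y r => [|k IH] p q x y r p0 q1 pq xb y01 xy.
  by exists x; split => //=; rewrite mulr0 addr0 mul1r.
have k0 : 0 <= k%:R :> R by rewrite ler0n.
have Lk : 0 <= L ^+ k by rewrite exprn_ge0 //; lin.
have grow : L * r + 2 * ga + 2 * ga * k%:R <= L * (r + 2 * ga * k.+1%:R).
  have : 0 <= (L - 1) * (2 * ga * (k%:R + 1)).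
    by apply: mulr_ge0; [lin|apply: mulr_ge0; lin].
  by rewrite -natr1 => *; lin.
have pq' : p <= q by lin.
have ls (h : R -> R) t1 t2 : Num.min 1 (s * (q - p)) <= h t2 - h t1 ->
    2 * ga <= h t2 - h t1.
  rewrite ge_min => /orP[|]; first by lin.
  have : 0 <= (s - 1) * (q - p) by apply: mulr_ge0; lin.
  by move=> *; lin.
have [t1 [t2 [t1b t2b ft /ls fl]]] := spread_hull (fe p0 pq' q1) xb.
have fl' : f t1 + 2 * ga <= f t2 by lin.
have [x'' [/andP[x1 x2] gx]] := fo_transl Fo (f y) fl' ft.
have [t3 [t3b ft3]] : exists t, btw t1 t2 t /\ f t = x''.
  by apply: ivt; [exact: perturb_contf|left].
have t3b' := btw_itv t1b t2b t3b.
have [t4 [t5 [t4b t5b Ft /ls Fl]]] := spread_hull (perturb_expand p0 pq' q1) t3b'.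
have Fxy : `|F t3 - F y| <= L * r + 2 * ga.
  rewrite /F /= ft3 distrC; apply: (le_trans gx).
  have : L * `|y - x| <= L * r by rewrite distrC; apply: ler_wpM2l => //; lin.
  by have := fL y x; lin.
have /andP[F40 _] := perturb_unit t4; have /andP[_ F51] := perturb_unit t5.
have Fl' : F t4 + 2 * ga <= F t5 by lin.
have [z [/andP[z1 z2] zH]] := IH _ _ _ _ _ F40 F51 Fl' Ft (perturb_unit y) Fxy.
have [t6 [t6b Ft6]] : exists t, btw t4 t5 t /\ F t = z.
  by apply: ivt; [exact: perturb_cont|left].
exists t6; split; first exact: btw_itv t4b t5b t6b.
rewrite !iterSr Ft6; apply: (le_trans zH).
rewrite exprSr -(mulrA (L ^+ k)); exact: ler_wpM2l.
Qed.

(** Induction on the number of remaining iterations: as long as the images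
stay [3 * ga]-close the hypothesis on [f c] and [f d] is reproduced, and at
the first separation [fo_local] applies, followed by [perturb_push]. *)
Lemma perturb_near n dl K : 3 <= K -> 3 * L <= K ->
  L ^+ n * ((K + 2) * ga + 2 * ga * n%:R) <= dl ->
  forall j c d, (j <= n)%N -> 0 <= c <= 1 -> 0 <= d <= 1 ->
  `|f c - f d| <= K * ga -> crook (iter j.+1 F) dl c d.
Proof.
move: (s1) (ga0) (gae) (eps1) (L1) => s1' ga0' gae' eps1' L1' K3 KL Hdl.
have n0 : 0 <= n%:R :> R by rewrite ler0n.
have Ln : 1 <= L ^+ n by rewrite exprn_ege1.
have dl3 : 3 * ga <= dl.
  apply: le_trans Hdl.
  have : 0 <= (L ^+ n - 1) * ((K + 2) * ga + 2 * ga * n%:R).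
    by apply: mulr_ge0; [lin|apply: addr_ge0; apply: mulr_ge0; lin].
  have : 0 <= 2 * ga * n%:R by apply: mulr_ge0; lin.
  have : 0 <= (K - 3) * ga by apply: mulr_ge0; lin.
  by move=> *; lin.
have bound j r : (j <= n)%N -> r <= (K + 2) * ga ->
    L ^+ j * (r + 2 * ga * j%:R) <= dl.
  move=> jn rK; apply: le_trans Hdl.
  have Lj : 0 <= L ^+ j by rewrite exprn_ge0 //; lin.
  have jn' : 2 * ga * j%:R <= 2 * ga * n%:R.
    by apply: ler_wpM2l; [lin|rewrite ler_nat].
  apply: (@le_trans _ _ (L ^+ j * ((K + 2) * ga + 2 * ga * n%:R))).
    by apply: ler_wpM2l => //; lin.
  apply: ler_wpM2r; last by rewrite ler_weXn2l.
  by apply: addr_ge0; apply: mulr_ge0; lin.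
have sep j c d : (j <= n)%N -> 0 <= c <= 1 -> 0 <= d <= 1 ->
    `|f c - f d| <= K * ga -> 3 * ga <= `|F c - F d| -> crook (iter j.+1 F) dl c d.
  move=> jn c01 d01 fcd Fcd; have K0 : 0 <= K by lin.
  have [x' [y' [b1 b2 e1 e2 [e3 e4]]]] := fo_local Fo (fu c) (fu d) K0 fcd Fcd.
  have [t1 [t1b ft1]] := ivt perturb_contf b1; rewrite -ft1 in b2 e1 e3.
  have [t2 [t2b ft2]] := ivt perturb_contf b2; rewrite -ft2 in e2 e4.
  have t101 := btw_itv c01 d01 t1b; have t201 := btw_itv t101 d01 t2b.
  have pushb u v y r : 0 <= u <= 1 -> 0 <= v <= 1 -> 0 <= y <= 1 ->
      2 * ga <= `|F u - F v| -> `|F v - F y| <= r -> r <= (K + 2) * ga ->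
      exists z, btw u v z /\ `|iter j.+1 F z - iter j.+1 F y| <= dl.
    move=> u01 v01 y01 uv vy rK.
    have /andP[u0 u1] := perturb_unit u; have /andP[v0 v1] := perturb_unit v.
    have [z [zb zH]] : exists z, btw (F u) (F v) z /\
        `|iter j F z - iter j F (F y)| <= L ^+ j * (r + 2 * ga * j%:R).
      have [uv'|uv'] := le_or_lt (F u) (F v).
        rewrite ler0_norm in uv; last by lin.
        have [||z [/andP[z1 z2] zH]] := @perturb_push j (F u) (F v)
          (F v) (F y) r u0 v1 _ _ (perturb_unit y) vy.
        - by lin.
        - by rewrite uv' lexx.
        by exists z; split => //; left.
      rewrite gtr0_norm in uv; last by lin.
      have [||z [/andP[z1 z2] zH]] := @perturb_push j (F v) (F u)
        (F v) (F y) r v0 u1 _ _ (perturb_unit y) vy.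
      - by lin.
      - by rewrite lexx ltW.
      by exists z; split => //; right.
    have [z' [z'b Fz']] := ivt perturb_cont zb.
    exists z'; split => //; rewrite !iterSr Fz'; apply: (le_trans zH).
    exact: bound.
  have [c' [cb cH]] := pushb c t1 d _ c01 t101 d01 e3 e1 (lexx _).
  have [|d' [db dH]] := pushb d t2 c ga d01 t201 c01 e4 e2.
    have : 0 <= (K + 1) * ga by apply: mulr_ge0; lin.
    by move=> *; lin.
  have [H1 H2] := btw_trans2 t1b t2b cb (btwC db).
  by exists c', d'.
elim=> [|j IH] c d jn c01 d01 fcd.
  have [Fcd|/ltW Fcd] := le_or_lt `|F c - F d| (3 * ga); last exact: sep.
  by apply: crook_refl => /=; apply: le_trans dl3.
have [Fcd|/ltW Fcd] := le_or_lt `|F c - F d| (3 * ga); last exact: sep.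
have -> : iter j.+2 F = iter j.+1 F \o F by apply/funext => x; rewrite iterSr.
apply: crook_comp; first exact: perturb_cont.
apply: IH; [exact: ltnW|exact: perturb_unit|exact: perturb_unit|].
apply: (le_trans (fL _ _)).
have : L * `|F c - F d| <= L * (3 * ga) by apply: ler_wpM2l; lin.
have : 0 <= (K - 3 * L) * ga by apply: mulr_ge0; lin.
by move=> *; lin.
Qed.

(** See the introduction: distant [f c] and [f d] are treated by covering,
close ones by [perturb_near]. *)
Lemma perturb_crook n dl K : 4 <= K -> 3 * L <= K ->
  1 <= s ^+ n * (eps / 4) ->
  L ^+ n * ((K + 2) * ga + 2 * ga * n%:R) <= dl ->
  forall c d, 0 <= c <= 1 -> 0 <= d <= 1 -> crook (iter n.+1 F) dl c d.
Proof.
move: (s1) (ga0) (gae) (eps1) (L1) => s1' ga0' gae' eps1' L1' K4 KL Hn Hdl c d c01 d01.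
have K3 : 3 <= K by lin.
have [fcd|/ltW fcd] := le_or_lt `|f c - f d| (K * ga).
  exact: (perturb_near K3 KL Hdl (leqnn n)).
have n0 : 0 <= n%:R :> R by rewrite ler0n.
have dl0 : 0 <= dl.
  apply: le_trans Hdl; apply: mulr_ge0; first by rewrite exprn_ge0 //; lin.
  by apply: addr_ge0; apply: mulr_ge0; lin.
have cont := perturb_cont; have contg := perturb_contg.
have cov0 x z t : 0 <= x -> z <= 1 -> x + 2 * ga <= z -> 0 <= t <= 1 ->
    exists u, x <= u <= z /\ iter n F (g u) = t.
  move=> x0 z1 xz t01.
  have xx : x <= x <= z by apply/andP; lin.
  have [u [v [ub vb _ uv]]] := spread_hull (fo_large Fo xz) xx.
  have unitg w : x <= w <= z -> 0 <= g w <= 1.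
    by move=> /andP[? ?]; apply: (fo_unit Fo); apply/andP; lin.
  have /andP[gu0 gu1] := unitg _ ub; have /andP[gv0 gv1] := unitg _ vb.
  have guv : g u <= g v by lin.
  have Hs : 1 <= s ^+ n * (g v - g u).
    by apply: (le_trans Hn); apply: ler_wpM2l; [rewrite exprn_ge0 //; lin|].
  have [||w [/andP[w1 w2] Fw]] := @expand_cover _ (iter n F) (s ^+ n) (g u) (g v) t _ _
      (expand_iter n cont perturb_unit s1 perturb_expand) gu0 guv gv1 Hs t01.
  - exact: cont_iter.
  - by move=> y; apply: unit_iter; exact: perturb_unit.
  have [u' [u'b gu']] : exists u', btw u v u' /\ g u' = w by apply: ivt => //; left.
  by exists u'; split; [exact: btw_itv ub vb u'b|rewrite gu'].
have cov x z t : 0 <= x <= 1 -> 0 <= z <= 1 -> 2 * ga <= `|x - z| -> 0 <= t <= 1 ->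
    exists u, btw x z u /\ iter n F (g u) = t.
  move=> /andP[x0 x1] /andP[z0 z1] xz t01; have [le|lt] := le_or_lt x z.
    rewrite ler0_norm in xz; last by lin.
    have [|u [/andP[u1 u2] uH]] := cov0 x z t x0 z1 _ t01; first by lin.
    by exists u; split => //; left.
  rewrite gtr0_norm in xz; last by lin.
  have [|u [/andP[u1 u2] uH]] := cov0 z x t z0 x1 _ t01; first by lin.
  by exists u; split => //; right.
pose z := (f c + f d) / 2.
have zb : btw (f c) (f d) z.
  by rewrite /z; have [?|?] := le_or_lt (f c) (f d); [left|right]; split; lin.
have z01 := btw_itv (fu c) (fu d) zb.
have fcd4 : 4 * ga <= `|f c - f d|.
  apply: le_trans fcd; have : 0 <= (K - 4) * ga by apply: mulr_ge0; lin.
  by move=> *; lin.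
have cz : 2 * ga <= `|f c - z|.
  have -> : f c - z = (f c - f d) / 2 by rewrite /z; field.
  by rewrite normrM (ger0_norm (_ : 0 <= 2^-1)) ?invr_ge0 //; lin.
have zd : 2 * ga <= `|z - f d|.
  have -> : z - f d = (f c - f d) / 2 by rewrite /z; field.
  by rewrite normrM (ger0_norm (_ : 0 <= 2^-1)) ?invr_ge0 //; lin.
have unitF x : 0 <= x <= 1 -> 0 <= iter n.+1 F x <= 1.
  exact: (unit_iter n.+1 perturb_unit).
have [x' [x'b x'H]] := cov _ _ _ (fu c) z01 cz (unitF d d01).
have [y' [y'b y'H]] := cov _ _ _ z01 (fu d) zd (unitF c c01).
have xb : btw (f c) (f d) x' := btw_sub zb x'b.
have [t1 [t1b ft1]] := ivt perturb_contf xb.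
have yb : btw (f t1) (f d) y'.
  by rewrite ft1; exact: btw_subr (btw_mono zb x'b) y'b.
have [t2 [t2b ft2]] := ivt perturb_contf yb.
exists t1, t2; split => //.
  by rewrite [iter n.+1 F t1]iterSr /F /= ft1 x'H /F subrr normr0.
by rewrite [iter n.+1 F t2]iterSr /F /= ft2 y'H /F subrr normr0.
Qed.

End Perturb.

(** * The limit map *)

(** What a stage of the construction must satisfy for [perturb_crook] to apply
to it. *)
Definition admissible (R : realType) (f : R -> R) :=
  [/\ unit_map f, expand f (3/2) & exists2 L, 1 <= L & lip L f].

(** The part of the conclusion at precision [dl]; both clauses persist under
small uniform perturbations. *)
Definition crooked_within (R : realType) (dl : R) (h : R -> R) :=
  (exists n, forall c d, 0 <= c <= 1 -> 0 <= d <= 1 -> crook (iter n h) dl c d) /\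
  (exists beta xi, [/\ 0 < beta, beta < dl, 0 < xi, xi < beta / 4 &
    forall c d, 0 <= c <= 1 -> 0 <= d <= 1 -> `|h c - h d| < beta -> crook h xi c d]).

Section Limit.
Variable R : realType.
Implicit Types (f F h : R -> R) (c d p q x y e dl tau : R).

Lemma crook_le h dl dl' c d : dl <= dl' -> crook h dl c d -> crook h dl' c d.
Proof.
by move=> le [c' [d' [? ? ? ?]]]; exists c', d'; split => //; exact: le_trans le.
Qed.

Lemma crooked_within_le dl dl' h : dl <= dl' -> crooked_within dl h -> crooked_within dl' h.
Proof.
move=> le [[n Hn] [be [xi [b0 b1 x0 x1 H]]]]; split.
  by exists n => c d c01 d01; exact: crook_le (Hn _ _ c01 d01).
by exists be, xi; split => //; exact: lt_le_trans le.
Qed.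

Lemma dist_perturb x y x' y' e : `|x - x'| <= e -> `|y - y'| <= e ->
  `|x - y| <= `|x' - y'| + 2 * e.
Proof.
move=> H1 H2; have -> : x - y = (x - x') + (x' - y') - (y - y') by ring.
apply: (le_trans (ler_normB _ _)).
have := ler_normD (x - x') (x' - y'); lin.
Qed.

Lemma crook_stable F h dl dl' e c d : (forall x, `|h x - F x| <= e) ->
  dl + 2 * e <= dl' -> crook F dl c d -> crook h dl' c d.
Proof.
move=> H le [c' [d' [? ? H1 H2]]]; exists c', d'; split => //.
  by have := dist_perturb (H c') (H d); lin.
by have := dist_perturb (H d') (H c); lin.
Qed.

(** Only the Lipschitz constant of the unperturbed map [F] enters. *)
Lemma iter_stable F h L tau n x : 1 <= L -> lip L F -> 0 <= tau ->
  (forall x, `|h x - F x| <= tau) ->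
  `|iter n h x - iter n F x| <= tau * (n%:R * L ^+ n).
Proof.
move=> L1 hL t0 H; elim: n => [|n IH] /=; first by rewrite subrr normr0 mul0r mulr0.
set u := iter n h x in IH *; set v := iter n F x in IH *.
have -> : h u - F v = (h u - F u) + (F u - F v) by ring.
apply: (le_trans (ler_normD _ _)).
have H1 := H u; have H2 := hL u v.
have H3 : L * `|u - v| <= L * (tau * (n%:R * L ^+ n)).
  by apply: ler_wpM2l => //; lin.
have Ln : 1 <= L ^+ n.+1 by rewrite exprn_ege1.
have H4 : 0 <= tau * (L ^+ n.+1 - 1) by apply: mulr_ge0 => //; lin.
rewrite exprS in H4 Ln *; rewrite -natr1.
by lin.
Qed.

Lemma pow_3_2_large x : exists n, x <= (3/2) ^+ n.
Proof.
pose B := Num.bound `|x|.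
have HB : `|x| < B%:R by apply: archi_boundP.
have pw k : k%:R <= (3/2) ^+ k * 2 :> R.
  elim: k => [|k IH]; first by rewrite expr0; lin.
  have P1 : 1 <= (3/2) ^+ k :> R by rewrite exprn_ege1 //; lin.
  by rewrite exprS -natr1; lin.
exists (B + B)%N.
by have h := pw (B + B)%N; rewrite natrD in h; have := ler_norm x; lin.
Qed.

(** The order of choices matters: [eps] from the tolerance [tau], then the
number [n] of iterations, then [ga], and finally the new tolerance, which
depends on the Lipschitz constant of the new map. *)
Lemma perturb_step f tau dl : admissible f -> 0 < tau -> 0 < dl ->
  exists F tau', [/\ admissible F, 0 < tau', tau' <= tau / 2,
    forall x, `|F x - f x| <= tau / 2 &
    forall h, (forall x, `|h x - F x| <= tau') -> crooked_within dl h].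
Proof.
move=> [fu fe [L L1 fL]] tau0 dl0.
pose eps := Num.min (1/2) (Num.min (tau / 2) (dl / 2)).
have eps0 : 0 < eps by rewrite !lt_min; apply/and3P; split; lin.
have eps1 : eps <= 1/2 by rewrite ge_min lexx.
have eps2 : eps <= tau / 2 by rewrite !ge_min lexx !orbT.
have eps3 : eps <= dl / 2 by rewrite !ge_min lexx !orbT.
have [n Hn] : exists n, 1 <= (3/2) ^+ n * (eps / 4) :> R.
  have [n pB] := pow_3_2_large (4 / eps); exists n.
  rewrite ler_pdivrMr // in pB; lin.
pose K := 3 * L + 4.
have n0 : 0 <= n%:R :> R by rewrite ler0n.
have Ln : 1 <= L ^+ n by rewrite exprn_ege1.
pose D := L ^+ n * ((K + 2) + 2 * n%:R).
have D0 : 0 < D by apply: mulr_gt0; rewrite /K; lin.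
have [g [ga [ga0 gaD ga22 Fo]]] : exists g ga, [/\ 0 < ga, ga <= dl / 3 / D,
    22 * ga <= eps & folding eps ga g].
  by apply: folding_exists => //; rewrite divr_gt0 // divr_gt0.
have gaD' : L ^+ n * ((K + 2) * ga + 2 * ga * n%:R) <= dl / 3.
  rewrite ler_pdivlMr // in gaD; apply: le_trans gaD.
  by rewrite /D; lin.
have s1 : 1 <= 3/2 :> R by lin.
have K4 : 4 <= K by rewrite /K; lin.
have KL : 3 * L <= K by rewrite /K; lin.
have crF := @perturb_crook _ f g L (3/2) eps ga L1 fL fu s1 fe ga0 ga22 eps1 Fo
  n (dl / 3) K K4 KL Hn gaD'.
have cF := perturb_cont fL Fo; have eF := perturb_expand fL fu s1 fe Fo.
have uF := perturb_unit fu Fo.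
pose F := g \o f.
have [Lg Lg1 gL] := fo_lip Fo.
have LF1 : 1 <= Lg * L by nra.
have FL : lip (Lg * L) F.
  move=> x y; apply: (le_trans (gL _ _)).
  by rewrite -mulrA; apply: ler_wpM2l; [lin|exact: fL].
pose E := n.+1%:R * (Lg * L) ^+ n.+1.
have E0 : 0 < E.
  by apply: mulr_gt0; rewrite ?ltr0n // exprn_gt0 //; lin.
pose tau' := Num.min (tau / 2) (Num.min ga (dl / 3 / E)).
have t0 : 0 < tau'.
  by rewrite !lt_min ga0 !divr_gt0.
have t1 : tau' <= tau / 2 by rewrite ge_min lexx.
have t2 : tau' <= ga by rewrite !ge_min lexx !orbT.
have t3 : tau' <= dl / 3 / E by rewrite !ge_min lexx !orbT.
rewrite ler_pdivlMr // in t3.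
exists F, tau'; split => //.
- by split => //; exists (Lg * L).
- by move=> x; apply: le_trans (fo_near Fo (fu x)) _.
move=> h hF; split.
  exists n.+1 => c d c01 d01.
  apply: (@crook_stable (iter n.+1 F) _ (dl / 3) _ (tau' * E)) (crF c d c01 d01).
    by move=> x; apply: iter_stable => //; exact: ltW.
  by lin.
(* a perturbation by [tau' <= ga] costs [2 * tau'] on the scale and on the precision *)
exists (eps - 2 * tau'), (3 * ga); split; try lin.
move=> c d c01 d01 Hcd.
apply: (@crook_stable F _ ga _ tau') => //; first by lin.
apply: crook_comp; first exact: lip_continuous fL.
apply: fo_crook Fo _ _ (fu c) (fu d) _.
have H' x : `|F x - h x| <= tau' by rewrite distrC.
by have := dist_perturb (H' c) (H' d); rewrite /F /=; lin.
Qed.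

Definition clamp x : R := Num.max 0 (Num.min 1 x).

(** The starting map: three full laps of slope 3, constant outside [0, 1]. An
interval containing two turning points covers everything, and otherwise at
least half of it lies in one lap. *)
Definition three_laps x : R := `|1 - `|1 - 3 * clamp x| |.

Lemma clamp_id x : 0 <= x <= 1 -> clamp x = x.
Proof.
move=> /andP[x0 x1]; rewrite /clamp.
by rewrite min_r // max_r.
Qed.

Lemma clamp01 x : 0 <= clamp x <= 1.
Proof.
rewrite /clamp le_max lexx /= ge_max ler01 /=.
by rewrite ge_min lexx.
Qed.

Lemma clamp_lip x y : `|clamp x - clamp y| <= `|x - y|.
Proof.
wlog xy : x y / x <= y.
  move=> H; have [/H //|/ltW /H] := le_or_lt x y.
  by rewrite distrC (distrC x).
have [x0|/ltW x0] := le_or_lt x 0.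
  have -> : clamp x = 0 by rewrite /clamp min_r ?max_l //; lin.
  have [y0|/ltW y0] := le_or_lt y 0.
    have -> : clamp y = 0 by rewrite /clamp min_r ?max_l //; lin.
    by rewrite subrr normr0.
  have [y1|/ltW y1] := le_or_lt y 1.
    by rewrite clamp_id ?y0 // !ler0_norm; lin.
  have -> : clamp y = 1 by rewrite /clamp min_l ?max_r //; lin.
  by rewrite !ler0_norm; lin.
have [x1|/ltW x1] := le_or_lt x 1.
  rewrite clamp_id ?x0 //.
  have [y1|/ltW y1] := le_or_lt y 1.
    by rewrite clamp_id //; apply/andP; lin.
  have -> : clamp y = 1 by rewrite /clamp min_l ?max_r //; lin.
  by rewrite !ler0_norm; lin.
have -> : clamp x = 1 by rewrite /clamp min_l ?max_r //; lin.
have -> : clamp y = 1 by rewrite /clamp min_l ?max_r //; lin.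
by rewrite subrr normr0.
Qed.

Lemma three_lapsA x : 0 <= x -> x <= 1/3 -> three_laps x = 3 * x.
Proof.
move=> x0 x1; rewrite /three_laps clamp_id; last by apply/andP; lin.
by rewrite (ger0_norm (_ : 0 <= 1 - 3 * x)) ?ger0_norm; lin.
Qed.

Lemma three_lapsB x : 1/3 <= x -> x <= 2/3 -> three_laps x = 2 - 3 * x.
Proof.
move=> x0 x1; rewrite /three_laps clamp_id; last by apply/andP; lin.
by rewrite (ler0_norm (_ : 1 - 3 * x <= 0)) ?ger0_norm; lin.
Qed.

Lemma three_lapsC x : 2/3 <= x -> x <= 1 -> three_laps x = 3 * x - 2.
Proof.
move=> x0 x1; rewrite /three_laps clamp_id; last by apply/andP; lin.
by rewrite (ler0_norm (_ : 1 - 3 * x <= 0)) ?ler0_norm; lin.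
Qed.

Lemma three_laps_admissible : admissible three_laps.
Proof.
split.
- move=> x; have /andP[c0 c1] := clamp01 x; rewrite normr_ge0 /=.
  have H : `|1 - 3 * clamp x| <= 2 by rewrite ler_norml; apply/andP; lin.
  by have H0 := normr_ge0 (1 - 3 * clamp x); rewrite ler_norml; apply/andP; lin.
- move=> p q p0 pq q1.
  have pp : p <= p <= q by rewrite lexx.
  have qq : p <= q <= q by rewrite lexx pq.
  have fin x y : p <= x <= q -> p <= y <= q -> 3/2 * (q - p) <= `|three_laps x - three_laps y| ->
      spread three_laps p q (Num.min 1 (3/2 * (q - p))).
    by move=> xb yb H; exists x, y; split => //; rewrite ge_min H orbT.
  have [qA|/ltW qA] := le_or_lt q (1/3).
    by apply: (fin q p) => //; rewrite !three_lapsA ?ger0_norm; lin.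
  have [pC|/ltW pC] := le_or_lt (2/3) p.
    by apply: (fin q p) => //; rewrite !three_lapsC ?ger0_norm; lin.
  have [pA|/ltW pA] := le_or_lt p (1/3); have [qB|/ltW qB] := le_or_lt q (2/3).
  + have mb : p <= 1/3 <= q by apply/andP; lin.
    have t13 : three_laps (1/3) = 1 by rewrite three_lapsA //; lin.
    have [le|/ltW le] := le_or_lt (1/3 - p) (q - 1/3).
      by apply: (fin (1/3) q) => //; rewrite t13 three_lapsB ?ger0_norm; lin.
    by apply: (fin (1/3) p) => //; rewrite t13 three_lapsA ?ger0_norm; lin.
  + exists (1/3), (2/3); split; try by apply/andP; lin.
    rewrite ge_min; apply/orP; left.
    by rewrite three_lapsA ?three_lapsC ?ger0_norm; lin.
  + by apply: (fin p q) => //; rewrite !three_lapsB ?ger0_norm; lin.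
  + have mb : p <= 2/3 <= q by apply/andP; lin.
    have t23 : three_laps (2/3) = 0 by rewrite three_lapsC //; lin.
    have [le|/ltW le] := le_or_lt (2/3 - p) (q - 2/3).
      by apply: (fin q (2/3)) => //; rewrite t23 three_lapsC ?ger0_norm; lin.
    by apply: (fin p (2/3)) => //; rewrite t23 three_lapsB ?ger0_norm; lin.
exists 3; first by lin.
have e (u v : R) : 1 - u - (1 - v) = v - u by ring.
move=> x y; apply: (le_trans (ler_dist_dist _ _)); rewrite e.
apply: (le_trans (ler_dist_dist _ _)); rewrite e -mulrBr normrM (ger0_norm (_ : 0 <= 3)) //.
by apply: ler_wpM2l => //; exact: clamp_lip.
Qed.

End Limit.

Section LimitMap.
Variable R : realType.
Implicit Types (f F h : R -> R) (c d p q x y e dl tau : R).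

(** A stage records its index, its map, and how far the limit may be from it. *)
Let stage := {p : nat * (R -> R) * R | admissible p.1.2 /\ 0 < p.2}.
Let sidx (s : stage) := (sval s).1.1.
Let sfun (s : stage) := (sval s).1.2.
Let stol (s : stage) := (sval s).2.

Let next (s s' : stage) :=
  [/\ sidx s' = (sidx s).+1, stol s' <= stol s / 2,
      forall x, `|sfun s' x - sfun s x| <= stol s / 2 &
      forall h, (forall x, `|h x - sfun s' x| <= stol s') ->
        crooked_within ((sidx s).+1%:R^-1) h].

Lemma stages : exists (f_ : nat -> R -> R) (tau_ : nat -> R),
  [/\ forall k, admissible (f_ k), forall k, 0 < tau_ k,
      forall k, tau_ k.+1 <= tau_ k / 2,
      forall k x, `|f_ k.+1 x - f_ k x| <= tau_ k / 2 &
      forall k h, (forall x, `|h x - f_ k.+1 x| <= tau_ k.+1) ->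
        crooked_within (k.+1%:R^-1) h].
Proof.
have nextP (s : stage) : {s' : stage | next s s'}.
  apply: cid; case: s => -[[k f] tau] [/= adf tau0].
  have dl0 : 0 < k.+1%:R^-1 :> R by rewrite invr_gt0 ltr0n.
  have [F [tau' [adF tau'0 tt Ff H]]] := perturb_step adf tau0 dl0.
  by exists (exist _ ((k.+1, F), tau') (conj adF tau'0)).
have ad0 : admissible (@three_laps R) /\ 0 < 1 :> R by split => //; exact: three_laps_admissible.
pose s0 : stage := exist _ ((0%N, @three_laps R), 1) ad0.
have [s_ [s_0 s_S]] := dependent_choice nextP s0.
have idx k : sidx (s_ k) = k.
  by elim: k => [|k IH]; [rewrite s_0|have [-> _ _ _] := s_S k; rewrite IH].
exists (fun k => sfun (s_ k)), (fun k => stol (s_ k)); split.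
- by move=> k; have [] := svalP (s_ k).
- by move=> k; have [] := svalP (s_ k).
- by move=> k; have [] := s_S k.
- by move=> k x; have [_ _ H _] := s_S k; exact: H.
- by move=> k h Hh; have [_ _ _ H] := s_S k; rewrite -{1}(idx k); exact: H.
Qed.

(** As the tolerances are halved, [f_ k - t_ k] increases and [f_ k + t_ k]
decreases with [k]; the supremum of the former is thus within [t_ k] of every
[f_ k]. *)
Theorem limit_map : exists f : R -> R,
  [/\ continuous f, unit_map f, expand f (3/2) & forall dl, 0 < dl -> crooked_within dl f].
Proof.
have [f_ [t_ [ad t0 tS fS withinS]]] := stages.
have mono x k j : f_ k x - t_ k <= f_ (k + j)%N x - t_ (k + j)%N /\
    f_ (k + j)%N x + t_ (k + j)%N <= f_ k x + t_ k.
  elim: j => [|j IH]; first by rewrite addn0.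
  rewrite addnS; have := fS (k + j)%N x; have := tS (k + j)%N; have := t0 (k + j)%N.
  rewrite ler_norml => ? ? /andP[? ?]; case: IH => ? ?; split; lra.
have cross x k j : f_ j x - t_ j <= f_ k x + t_ k.
  have tk := t0 k; have tj := t0 j.
  have [jk|/ltnW kj] := leqP j k.
    by have [+ _] := mono x j (k - j)%N; rewrite subnKC //; lra.
  by have [_ +] := mono x k (j - k)%N; rewrite subnKC //; lra.
pose f x := sup [set f_ k x - t_ k | k in [set: nat]].
have hs x : has_sup [set f_ k x - t_ k | k in [set: nat]].
  split; first by exists (f_ 0%N x - t_ 0%N), 0%N.
  by exists (f_ 0%N x + t_ 0%N) => _ [k _ <-].
have close k x : `|f x - f_ k x| <= t_ k.
  have h1 : f_ k x - t_ k <= f x by apply: sup_upper_bound => //; exists k.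
  have h2 : f x <= f_ k x + t_ k.
    apply: ge_sup; first by case: (hs x).
    by move=> _ [j _ <-].
  by rewrite ler_norml; apply/andP; lra.
have small e : 0 < e -> exists k, t_ k < e.
  move=> e0; pose N := Num.bound (t_ 0%N / e).
  have HN : t_ 0%N / e < N%:R.
    by apply: archi_boundP; rewrite divr_ge0 // ltW.
  have pw k : k%:R * t_ k <= t_ 0%N.
    suff : (k%:R + 1) * t_ k <= t_ 0%N by have := t0 k; lra.
    elim: k => [|k IH]; first by rewrite add0r mul1r.
    have k0 : 0 <= k%:R :> R by rewrite ler0n.
    have h1 := t0 k; have h2 := tS k; have h3 := t0 k.+1.
    have h4 : 0 <= (k%:R + 2) * (t_ k / 2 - t_ k.+1) by apply: mulr_ge0; lra.
    have h5 : 0 <= k%:R * t_ k by apply: mulr_ge0; lra.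
    by rewrite -natr1; lra.
  exists N; rewrite ltr_pdivrMr // in HN; have h := pw N; have N0 := t0 N.
  have {}N0 : 0 < N%:R :> R.
    rewrite ltr0n lt0n; apply/eqP => N_eq0; rewrite N_eq0 mul0r in HN.
    by have := t0 0%N; lra.
  by rewrite -(ltr_pM2l N0); lra.
have fc : continuous f.
  move=> x; apply/cvgrPdist_le => e e0.
  have [k tk] : exists k, t_ k < e / 4 by apply: small; lra.
  have [_ _ [L _ hL]] := ad k; have ck := lip_continuous hL.
  have /cvgrPdist_le/(_ (e / 4)) H := ck x.
  have e4 : 0 < e / 4 by lra.
  near=> y.
  have Hy : `|f_ k x - f_ k y| <= e / 4 by near: y; exact: H.
  by have := dist_perturb (close k x) (close k y); lra.
exists f; split => //.
- move=> x; apply/andP; split; rewrite leNgt; apply/negP => H.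
    have [k tk] : exists k, t_ k < - f x by apply: small; lra.
    have [/(_ x)/andP[h0 h1] _ _] := ad k.
    by have := close k x; rewrite ler_norml => /andP[? ?]; lra.
  have [k tk] : exists k, t_ k < f x - 1 by apply: small; lra.
  have [/(_ x)/andP[h0 h1] _ _] := ad k.
  by have := close k x; rewrite ler_norml => /andP[? ?]; lra.
- move=> p q p0 pq q1.
  have cw : {within `[p, q], continuous f} by exact: continuous_subspaceT.
  have [y yb yM] := derive.EVT_max pq cw; have [x xb xm] := derive.EVT_min pq cw.
  exists y, x; rewrite !in_itv /= in xb yb; split => //.
  apply: (@le_trans _ _ (f y - f x)); last exact: ler_norm.
  rewrite leNgt; apply/negP => H.
  set v := Num.min 1 _ in H.
  have [k tk] : exists k, t_ k < (v - (f y - f x)) / 2 by apply: small; lra.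
  have [_ /(_ p q p0 pq q1)[u [w [ub wb uw]]] _] := ad k.
  have ck z : `|f_ k z - f z| <= t_ k by rewrite distrC.
  have h := dist_perturb (ck u) (ck w).
  have yu := yM u; have yw := yM w; have xu := xm u; have xw := xm w.
  rewrite !in_itv /= in yu yw xu xw.
  have {}yu := yu ub; have {}yw := yw wb; have {}xu := xu ub; have {}xw := xw wb.
  have : `|f u - f w| <= f y - f x by rewrite ler_norml; apply/andP; lra.
  by rewrite -/v in uw; lra.
- move=> dl dl0; pose N := Num.bound dl^-1.
  have HN : dl^-1 < N%:R by apply: archi_boundP; rewrite invr_ge0 ltW.
  apply: (@crooked_within_le _ (N.+1%:R^-1)).
    rewrite -[dl]invrK lef_pV2 ?posrE ?invr_gt0 ?ltr0n //.
    by rewrite -natr1; lra.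
  by apply: withinS => x; exact: close.
Unshelve. all: by end_near. Qed.

End LimitMap.

(** * The unit interval as a space *)

Section UnitInterval.
Variable R : realType.
Local Notation I := (unit_interval R).
Implicit Types (a b c d : I) (x y e : R).

Lemma clamp_in x : clamp x \in [set` `[(0 : R), 1]].
Proof. by apply: mem_set => /=; rewrite in_itv /= clamp01. Qed.

(** Clamping makes this retraction total and 1-Lipschitz, so that compactness
and connectedness of the interval transfer to the subtype. *)
Definition to_unit x : I := exist _ (clamp x) (clamp_in x).

Lemma unit01 a : 0 <= \val a <= 1.
Proof. by case: a => x /= /set_mem /=; rewrite in_itv. Qed.

Lemma to_unitK x : 0 <= x <= 1 -> \val (to_unit x) = x.
Proof. exact: clamp_id. Qed.

Lemma valK_unit a : to_unit (\val a) = a.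
Proof. by apply: val_inj; rewrite to_unitK // unit01. Qed.

Lemma unit_nbhsP a (A : set I) :
  nbhs a A <-> exists2 e, 0 < e & forall b, `|\val a - \val b| < e -> A b.
Proof.
split.
  case=> _ /= [[W Wop <-] Wa WA].
  have /nbhs_ballP[e /= e0 eW] : nbhs (\val a) W by exact: open_nbhs_nbhs.
  by exists e => // b ab; apply: WA; apply: eW.
case=> e e0 H.
have : nbhs a ((fun b : I => \val b) @^-1` ball (\val a) e).
  have cv : continuous (fun b : I => \val b) by exact: initial_continuous.
  by apply: cv; exact: nbhsx_ballx.
by apply: filterS => b; exact: H.
Qed.

Lemma unit_val_cont : continuous (fun a : I => \val a : R).
Proof. exact: initial_continuous. Qed.

Lemma to_unit_cont : continuous to_unit.
Proof.
move=> x A /unit_nbhsP[e e0 H].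
apply: (@filterS _ _ _ (ball x e)); last exact: nbhsx_ballx.
by move=> y; rewrite /ball /= => xy; apply: H; apply: le_lt_trans xy; exact: clamp_lip.
Qed.

Lemma unit_image : to_unit @` `[0, 1] = [set: I].
Proof.
apply/seteqP; split => // a _; exists (\val a); last exact: valK_unit.
by rewrite /= in_itv /= unit01.
Qed.

Lemma unit_compact : compact [set: I].
Proof.
rewrite -unit_image; apply: continuous_compact; last exact: segment_compact.
exact/continuous_subspaceT/to_unit_cont.
Qed.

Lemma unit_connected : connected [set: I].
Proof.
rewrite -unit_image; apply: connected_continuous_connected; first exact: segment_connected.
exact/continuous_subspaceT/to_unit_cont.
Qed.

Lemma unit_unif_cont (h : I -> I) e : continuous h -> 0 < e ->
  exists2 dl : R, 0 < dl & forall a b, `|\val a - \val b| < dl ->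
    `|\val (h a) - \val (h b)| < e.
Proof.
move=> ch e0.
have /compact_near_coveringP/(_ _ (0^'+ : set_system R)
   (fun dl a => forall b, `|\val a - \val b| < dl -> `|\val (h a) - \val (h b)| < e)) := unit_compact.
case.
  move=> a _; have /ch/unit_nbhsP[r r0 Hr] : nbhs (h a) [set b | `|\val (h a) - \val b| < e / 2].
    by apply/unit_nbhsP; exists (e / 2) => //; rewrite divr_gt0.
  have r2 : 0 < r / 2 by rewrite divr_gt0.
  exists ([set b | `|\val a - \val b| < r / 2], [set dl | dl < r / 2]).
    split => /=; first by apply/unit_nbhsP; exists (r / 2).
    exact: nbhs_right_lt.
  move=> [a' dl] /= [aa' dlr] b a'b.
  have h1 : `|\val (h a) - \val (h a')| < e / 2 by apply: Hr; lra.
  have h2 : `|\val (h a) - \val (h b)| < e / 2.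
    apply: Hr; have := ler_normD (\val a - \val a') (\val a' - \val b).
    by rewrite addrA subrK; lra.
  have := ler_normD (\val (h a') - \val (h a)) (\val (h a) - \val (h b)).
  by rewrite addrA subrK (distrC (\val (h a')) (\val (h a))); lra.
move=> r /= r0 H; exists (r / 2); first by rewrite divr_gt0.
move=> x b; apply: H => //=; last by rewrite divr_gt0.
by rewrite sub0r normrN gtr0_norm; lra.
Qed.

End UnitInterval.

(** * Inverse limits of intervals *)

Lemma compact_set_type (T : topologicalType) (A : set T) :
  compact A -> compact [set: set_type A].
Proof.
move=> cA F PF _.
have FA : (set_val @ F) A.
  apply: (@filterS _ F _ setT); last exact: filterT.
  by move=> x _; exact: set_valP.
have [p [Ap clp]] := cA (set_val @ F) (fmap_proper_filter _ PF) FA.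
exists (exist _ p (mem_set Ap)); split => // B C FB [_ /= [[W Wop <-] Wp WC]].
have [||y [[x Bx <-] Wy]] := clp (set_val @` B) W.
- by apply: (@filterS _ F _ B) => // x Bx; exists x.
- exact: open_nbhs_nbhs.
by exists x; split => //; exact: WC.
Qed.

Section InverseLimit.
Variable R : realType.
Local Notation I := (unit_interval R).
Variable f : I -> I.
Local Notation X := (set_type (inverse_limit f)).
Implicit Types (x y : X) (n N i j : nat) (e dl : R).

Definition coord n x : I := \val x n.

Definition cdist n x y : R := `|\val (coord n x) - \val (coord n y)|.

Lemma coordS n x : coord n x = f (coord n.+1 x).
Proof. by rewrite /coord; case: x => x /= /set_mem. Qed.

Lemma coord_iter n k x : coord n x = iter k f (coord (n + k) x).
Proof.
elim: k => [|k IH]; first by rewrite addn0.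
by rewrite IH coordS addnS iterSr.
Qed.

Lemma coord_eq_le N n x y : (N <= n)%N -> coord n x = coord n y ->
  coord N x = coord N y.
Proof. by move=> Nn; rewrite !(coord_iter N (n - N)) subnKC // => ->. Qed.

Lemma coord_inj x y : (forall n, coord n x = coord n y) -> x = y.
Proof. by move=> H; apply/val_inj/funext => n; exact: H. Qed.

Hypothesis fcont : continuous f.

Lemma coord_cont n : continuous (coord n).
Proof.
move=> x; apply: (@continuous_comp _ _ _ set_val (fun z : prod_topology (fun _ : nat => I) => z n)).
  exact: initial_continuous.
exact: proj_continuous.
Qed.

Lemma rcoord_cont n : continuous (fun x => \val (coord n x) : R).
Proof.
move=> x; apply: (@continuous_comp _ _ _ (coord n) (fun a : I => \val a : R)).
  exact: coord_cont.
exact: unit_val_cont.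
Qed.

Lemma cdist_control N e : 0 < e -> exists2 dl : R, 0 < dl &
  forall x y, cdist N x y < dl -> forall i, (i <= N)%N -> cdist i x y < e.
Proof.
move=> e0; elim: N => [|N [dl dl0 IH]].
  by exists e => // x y H i; rewrite leqn0 => /eqP ->.
have [dl' dl'0 H] := unit_unif_cont fcont dl0.
exists (Num.min e dl'); first by rewrite lt_min e0.
move=> x y; rewrite lt_min => /andP[h1 h2] i; rewrite leq_eqVlt ltnS => /orP[/eqP -> //|].
by apply: IH; rewrite /cdist !(coordS N); exact: H.
Qed.

(** A single coordinate suffices to describe neighbourhoods, since by
[cdist_control] it controls all the previous ones. *)
Lemma ilim_nbhsP x (A : set X) : nbhs x A <->
  exists N, exists2 dl : R, 0 < dl & forall y, cdist N x y < dl -> A y.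
Proof.
split; last first.
  move=> [N [dl dl0 H]].
  have : nbhs x ((fun y : X => \val (coord N y)) @^-1` ball (\val (coord N x)) dl).
    by apply: (@rcoord_cont N x); exact: nbhsx_ballx.
  by apply: filterS => y; exact: H.
pose G : set_system (prod_topology (fun _ : nat => I)) := fun W =>
  exists N, exists2 dl : R, 0 < dl & forall y, cdist N x y < dl -> W (\val y).
have GF : Filter G.
  split.
  - by exists 0%N; exists 1.
  - move=> P Q [N1 [d1 d10 H1]] [N2 [d2 d20 H2]].
    have d0 : 0 < Num.min d1 d2 by rewrite lt_min d10.
    have [dl dl0 H] := cdist_control (maxn N1 N2) d0.
    exists (maxn N1 N2), dl => // y /H Hy; split.
      by apply: H1; have := Hy N1 (leq_maxl _ _); rewrite lt_min => /andP[].
    by apply: H2; have := Hy N2 (leq_maxr _ _); rewrite lt_min => /andP[].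
  - by move=> P Q PQ [N [dl dl0 H]]; exists N, dl => // y /H /PQ.
have Gx : G --> (\val x : prod_topology (fun _ : nat => I)).
  apply/cvg_sup => i W [_ /= [[V Vop <-] Vx VW]].
  have /unit_nbhsP[e e0 He] : nbhs (coord i x) V by exact: open_nbhs_nbhs.
  by exists i, e => // y Hy; apply: VW; exact: He.
move=> [_ /= [[W Wop <-] Wx WA]].
have [|N [dl dl0 H]] := Gx W; first exact: open_nbhs_nbhs.
by exists N, dl => // y Hy; apply: WA; exact: H.
Qed.

Lemma ilim_hausdorff : hausdorff_space X.
Proof.
move=> p q H; apply: contrapT => pq.
have [n npq] : exists n, coord n p <> coord n q.
  by apply/existsNP => K; apply/pq/coord_inj.
pose r := cdist n p q / 2.
have r0 : 0 < r.
  rewrite divr_gt0 // normr_gt0 subr_eq0; apply/eqP => e; apply: npq.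
  exact: val_inj.
have Np : nbhs p [set y | cdist n p y < r] by apply/ilim_nbhsP; exists n, r.
have Nq : nbhs q [set y | cdist n q y < r] by apply/ilim_nbhsP; exists n, r.
have [y [/= yp yq]] := H _ _ Np Nq.
have := ler_normD (\val (coord n p) - \val (coord n y)) (\val (coord n y) - \val (coord n q)).
rewrite addrA subrK; rewrite /cdist in yp; rewrite /cdist distrC in yq.
rewrite -/(cdist n p q); move: yp yq; rewrite /r /cdist; lra.
Qed.

Lemma ilim_closed : closed (inverse_limit f).
Proof.
have -> : inverse_limit f = \bigcap_(i in [set: nat])
    (fun x : prod_topology (fun _ : nat => I) => \val (x i) - \val (f (x i.+1)) : R)
      @^-1` [set x | x = 0].
  apply/seteqP; split => [x xf i _ /=|x xf i].
    by rewrite {1}xf subrr.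
  by apply: val_inj; apply/eqP; rewrite -subr_eq0; apply/eqP; exact: (xf i Logic.I).
apply: closed_bigI => i _.
have cval (h : prod_topology (fun _ : nat => I) -> I) :
    continuous h -> continuous (fun z => \val (h z) : R).
  move=> ch z; apply: (@continuous_comp _ _ _ h (fun a : I => \val a : R)).
    exact: ch.
  exact: unit_val_cont.
have cproj j : continuous (fun z : prod_topology (fun _ : nat => I) => z j).
  exact: (@proj_continuous _ (fun=> I)).
have cdiff : continuous
  (fun x : prod_topology (fun _ : nat => I) => \val (x i) - \val (f (x i.+1)) : R).
  move=> z; apply: (@cvgB _ R); [exact: nbhs_filter|exact: (cval (fun z => z i) (cproj i) z)|].
  apply: (cval (fun z => f (z i.+1)) _ z) => {}z.
  apply: (@continuous_comp _ _ _ (fun z : prod_topology (fun _ : nat => I) => z i.+1) f).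
    exact: cproj.
  exact: fcont.
by move/continuous_closedP: cdiff; apply; exact: closed_eq.
Qed.

Lemma ilim_compact : compact [set: X].
Proof.
apply: compact_set_type.
apply: (subclosed_compact ilim_closed (@tychonoff nat (fun _ => I) (fun _ => setT) _)).
  by move=> _; exact: unit_compact.
by [].
Qed.

Hypothesis fsurj : forall b, exists a, f a = b.

Lemma coord_surj N (a : I) : exists x, coord N x = a.
Proof.
have [s sK] := choice fsurj.
pose z i : I := if (i <= N)%N then iter (N - i) f a else iter (i - N) s a.
have zP : z \in inverse_limit f.
  apply: mem_set => i; rewrite /z; have [iN|Ni|->] := ltngtP i N.
  - by rewrite -iterS subnSK.
  - by rewrite subSn /= ?sK // ltnW.
  - by rewrite subnn subSnn /= sK.
by exists (exist _ z zP); rewrite /coord /= /z leqnn subnn.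
Qed.

(** By compactness some coordinate separates a clopen set from its complement;
the two images are then closed, disjoint, and cover the interval. *)
Lemma ilim_connected : connected [set: X].
Proof.
move=> B [b Bb] [U Uop BU] [V Vcl BV].
rewrite setTI in BU; rewrite setTI in BV.
have Bop : open B by rewrite BU.
have Bcl : closed B by rewrite BV.
apply: contrapT => BT.
have [y By] : exists y, ~ B y.
  by apply/existsNP => H; apply: BT; apply/seteqP; split.
have [n [_ sep]] : exists n, True /\ forall x, forall z : X, coord n x = coord n z -> B x -> B z.
  have /compact_near_coveringP/(_ nat \oo
    (fun n (x : X) => forall z : X, coord n x = coord n z -> B x -> B z)) := ilim_compact.
  case.
    move=> x _.
    have [N [dl dl0 H]] : exists N, exists2 dl : R, 0 < dl &
        (forall y, cdist N x y < dl -> B y) \/ (forall y, cdist N x y < dl -> ~ B y).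
      have [Bx|nBx] := pselect (B x).
        have /ilim_nbhsP[N [dl dl0 H]] : nbhs x B by exact: open_nbhs_nbhs.
        by exists N, dl => //; left.
      have /ilim_nbhsP[N [dl dl0 H]] : nbhs x (~` B).
        by apply: open_nbhs_nbhs; split => //; exact: closed_openC.
      by exists N, dl => //; right.
    exists ([set x' | cdist N x x' < dl], [set n | (N <= n)%N]).
      by split => /=; [apply/ilim_nbhsP; exists N, dl|exists N].
    move=> [x' n] /= [xx' Nn] z zx' Bx'.
    have xz : cdist N x z < dl.
      by rewrite /cdist -(coord_eq_le Nn zx').
    by case: H => H; [exact: H|have := H _ xx'].
  move=> N _ H; exists N; split => // x; exact: (H N (leqnn N) x Logic.I).
have compl : coord n @` (~` B) = ~` (coord n @` B).
  apply/seteqP; split => [_ [x nBx <-] [z Bz zx]|a nBa].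
    by apply: nBx; exact: sep zx Bz.
  have [x xa] := coord_surj n a; exists x => // Bx; apply: nBa; by exists x.
have clos (A : set X) : closed A -> closed (coord n @` A).
  move=> Acl; apply: compact_closed.
    move=> p q H; apply: contrapT => pq.
    pose r := `|\val p - \val q| / 2.
    have r0 : 0 < r.
      by rewrite divr_gt0 // normr_gt0 subr_eq0; apply/eqP => e; apply/pq/val_inj.
    have [||w [/= h1 h2]] := H [set w | `|\val p - \val w| < r] [set w | `|\val q - \val w| < r].
    - by apply/unit_nbhsP; exists r.
    - by apply/unit_nbhsP; exists r.
    have := ler_normD (\val p - \val w) (\val w - \val q).
    by rewrite addrA subrK (distrC (\val w)) -/r; move: h1 h2; rewrite /r; lra.
  apply: continuous_compact; first exact/continuous_subspaceT/coord_cont.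
  exact: (subclosed_compact Acl ilim_compact).
have : coord n @` B = setT.
  apply: (@unit_connected R).
  - by exists (coord n b), b.
  - exists (coord n @` B); last by rewrite setTI.
    by rewrite -[X in open X]setCK -compl; apply: closed_openC; apply: clos; exact: open_closedC.
  - by exists (coord n @` B); [exact: clos|rewrite setTI].
move=> /seteqP[_ /(_ (coord n y) Logic.I)[x Bx xy]].
by apply: By; exact: sep xy Bx.
Qed.

End InverseLimit.

Section PseudoArc.
Variable R : realType.
Local Notation I := (unit_interval R).
Variable f : I -> I.
Hypotheses (fcont : continuous f) (fsurj : forall b, exists a, f a = b).
Local Notation X := (set_type (inverse_limit f)).
Implicit Types (x y z : X) (n N i j : nat) (e dl : R).

Definition ilim_dist x y : R := sup [set 2^-1 ^+ n * cdist n x y | n in [set: nat]].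

Lemma cdist_ge0 n x y : 0 <= cdist n x y.
Proof. exact: normr_ge0. Qed.

Lemma cdist_le1 n x y : cdist n x y <= 1.
Proof.
have /andP[? ?] := unit01 (coord n x); have /andP[? ?] := unit01 (coord n y).
by rewrite /cdist ler_norml; apply/andP; lra.
Qed.

Lemma half_pow n : 0 < (2^-1 : R) ^+ n <= 1.
Proof.
apply/andP; split; first by rewrite exprn_gt0 // invr_gt0.
by apply: exprn_ile1; lra.
Qed.

Lemma ilim_dist_has_sup x y : has_sup [set 2^-1 ^+ n * cdist n x y | n in [set: nat]].
Proof.
split; first by exists (2^-1 ^+ 0 * cdist 0 x y), 0%N.
exists 1 => _ [n _ <-]; have /andP[? ?] := half_pow n.
by have := cdist_ge0 n x y; have := cdist_le1 n x y; nra.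
Qed.

Lemma ilim_dist_ge n x y : 2^-1 ^+ n * cdist n x y <= ilim_dist x y.
Proof. by apply: sup_upper_bound; [exact: ilim_dist_has_sup|exists n]. Qed.

Lemma ilim_dist_le x y e : (forall n, 2^-1 ^+ n * cdist n x y <= e) -> ilim_dist x y <= e.
Proof.
move=> H; apply: ge_sup; first by case: (ilim_dist_has_sup x y).
by move=> _ [n _ <-].
Qed.

(** The weights make the coordinates beyond [N] negligible. *)
Lemma ilim_dist_unif e : 0 < e -> exists N, exists2 dl : R, 0 < dl &
  forall x y, cdist N x y < dl -> ilim_dist x y < e.
Proof.
move=> e0; have e2 : 0 < e / 2 by rewrite divr_gt0.
have [N HN] : exists N, forall n, (N <= n)%N -> 2^-1 ^+ n <= e / 2 :> R.
  pose N := Num.bound (2 / e); exists N => n Nn.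
  have HN : 2 / e < N%:R by apply: archi_boundP; rewrite divr_ge0 // ltW.
  have nN : N%:R <= n%:R :> R by rewrite ler_nat.
  have pw k : k%:R * 2^-1 ^+ k <= 1 :> R.
    elim: k => [|k IH]; first by rewrite mul0r.
    have /andP[_ ?] := half_pow k; have /andP[_ ?] := half_pow k.+1.
    by rewrite exprS -natr1; lra.
  have /andP[p0 _] := half_pow n; have h := pw n.
  rewrite ltr_pdivrMr // in HN.
  have : 0 <= (n%:R - N%:R) * (e * 2^-1 ^+ n) by apply: mulr_ge0; [lra|apply: mulr_ge0; lra].
  have : 0 <= (N%:R * e - 2) * 2^-1 ^+ n by apply: mulr_ge0; lra.
  have : n%:R * 2^-1 ^+ n * e <= 1 * e by apply: ler_wpM2r => //; lra.
  by move=> *; lra.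
have [dl dl0 H] := cdist_control fcont N e2.
exists N, dl => // x y xy; apply: (@le_lt_trans _ _ (e / 2)); last by lra.
apply: ilim_dist_le => n; have /andP[? ?] := half_pow n.
have ? := cdist_ge0 n x y; have ? := cdist_le1 n x y.
have [nN|/ltnW Nn] := leqP n N; last by have := HN n Nn; nra.
by have := H x y xy n nN; nra.
Qed.

Lemma ilim_dist_metrizes : metrizes ilim_dist.
Proof.
split.
- move=> x y; apply: le_trans (ilim_dist_ge 0 x y).
  by rewrite expr0 mul1r cdist_ge0.
- move=> x y; split => [d0|->].
    apply: coord_inj => n; apply: val_inj; apply/eqP.
    rewrite -subr_eq0 -normr_le0.
    have := ilim_dist_ge n x y; rewrite d0 pmulr_rle0 //.
    by case/andP: (half_pow n).
  apply/eqP; rewrite eq_le; apply/andP; split.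
    by apply: ilim_dist_le => n; rewrite /cdist subrr normr0 mulr0.
  by apply: le_trans (ilim_dist_ge 0 y y); rewrite expr0 mul1r cdist_ge0.
- move=> x y; rewrite /ilim_dist; congr (sup [set _ | _ in _]).
  by apply/funext => n; rewrite /cdist distrC.
- move=> x y z; apply: ilim_dist_le => n.
  apply: le_trans (lerD (ilim_dist_ge n x y) (ilim_dist_ge n y z)).
  rewrite -mulrDr; apply: ler_wpM2l; first by case/andP: (half_pow n) => /ltW.
  have := ler_normD (\val (coord n x) - \val (coord n y)) (\val (coord n y) - \val (coord n z)).
  by rewrite addrA subrK.
- move=> x A; split.
    move=> /(ilim_nbhsP fcont)[N [dl dl0 H]].
    have /andP[p0 _] := half_pow N.
    exists (2^-1 ^+ N * dl); first exact: mulr_gt0.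
    move=> y /= xy; apply: H; rewrite -(ltr_pM2l p0).
    exact: le_lt_trans (ilim_dist_ge N x y) xy.
  move=> [e e0 eA]; apply/(ilim_nbhsP fcont).
  have [N [dl dl0 H]] := ilim_dist_unif e0.
  by exists N, dl => // y xy; apply: eA; exact: H.
Qed.

Lemma ilim_continuum : continuum R X.
Proof.
split.
- have [x _] := coord_surj fsurj 0 (to_unit 0); by exists x.
- exact: ilim_compact.
- exact: ilim_connected.
- by exists ilim_dist; exact: ilim_dist_metrizes.
Qed.

Lemma ilim_nondegenerate : Defs.nondegenerate X.
Proof.
have [x hx] := coord_surj fsurj 0 (to_unit (0 : R)).
have [y hy] := coord_surj fsurj 0 (to_unit (1 : R)).
exists x, y => xy; have : \val (coord 0 x) = \val (coord 0 y) by rewrite xy.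
rewrite hx hy !to_unitK ?lexx ?ler01 // => /eqP.
by rewrite eq_sym oner_eq0.
Qed.

(** Pull back the open intervals of radius [1 / M] centred at the multiples of
[1 / M] by a coordinate fine enough for [ilim_dist_unif]. *)
Lemma ilim_chainable : chainable R X.
Proof.
exists ilim_dist; first exact: ilim_dist_metrizes.
move=> e e0; have [N [dl dl0 Hd]] := ilim_dist_unif e0.
pose M := (Num.bound (2 / dl)).+1.
have M0 : 0 < M%:R :> R by rewrite ltr0n.
have HM : 2 < M%:R * dl.
  rewrite -ltr_pdivrMr //.
  have h : 2 / dl < (Num.bound (2 / dl))%:R by apply: archi_boundP; rewrite divr_ge0 // ltW.
  by apply: (lt_le_trans h); rewrite ler_nat.
pose C (k : 'I_M.+1) : set X := [set x | `|M%:R * \val (coord N x) - k%:R| < 1].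
exists M.+1, C; split.
- split.
    move=> k; rewrite openE => x; rewrite {1}/C /= => Cx; apply/(ilim_nbhsP fcont).
    exists N, ((1 - `|M%:R * \val (coord N x) - k%:R|) / M%:R).
      by rewrite divr_gt0 //; lra.
    move=> y; rewrite ltr_pdivlMr // => xy; rewrite /C /=.
    have -> : M%:R * \val (coord N y) - k%:R =
      (M%:R * \val (coord N x) - k%:R) - M%:R * (\val (coord N x) - \val (coord N y)) by ring.
    apply: (le_lt_trans (ler_normB _ _)).
    rewrite (normrM M%:R) (ger0_norm (ltW M0)).
    by move: xy; rewrite /cdist; lra.
  move=> i j; split.
    move=> [x [/= xi xj]].
    move: xi xj; rewrite /C /= !ltr_norml => /andP[? ?] /andP[? ?].
    by apply/andP; split; rewrite -ltnS -(ltr_nat R); lra.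
  move=> /andP[ij ji].
  have ij' : i%:R <= j%:R + 1 :> R by rewrite natr1 ler_nat.
  have ji' : j%:R <= i%:R + 1 :> R by rewrite natr1 ler_nat.
  have iM : i%:R <= M%:R :> R by rewrite ler_nat -ltnS.
  have jM : j%:R <= M%:R :> R by rewrite ler_nat -ltnS.
  have i0 : 0 <= i%:R :> R by rewrite ler0n.
  have j0 : 0 <= j%:R :> R by rewrite ler0n.
  pose t : R := (i%:R + j%:R) / 2 / M%:R.
  have t01 : 0 <= t <= 1.
    by rewrite /t divr_ge0 ?(ltW M0) ?ler_pdivrMr //=; lra.
  have Mt : M%:R * t = (i%:R + j%:R) / 2 by rewrite /t; field; lra.
  have [x xt] := coord_surj fsurj N (to_unit t).
  exists x; split; rewrite /C /= xt to_unitK // Mt ltr_norml; apply/andP; lra.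
- apply/seteqP; split => // x _.
  have /andP[t0 t1] := unit01 (coord N x); set t := \val (coord N x) in t0 t1.
  have Mt0 : 0 <= M%:R * t by apply: mulr_ge0; lra.
  have /andP[k0 k1] := truncn_itv Mt0.
  have kM : (Num.trunc (M%:R * t) < M.+1)%N.
    rewrite ltnS -(ler_nat R); apply: (le_trans k0).
    by rewrite -[leRHS]mulr1; apply: ler_wpM2l => //; exact: ltW.
  exists (Ordinal kM) => //=; rewrite /C /= -/t ltr_norml.
  by rewrite -natr1 in k1; apply/andP; lra.
move=> k x y /= xk yk; apply: Hd; rewrite -(ltr_pM2l M0).
rewrite /cdist -[X in X * `|_|](ger0_norm (ltW M0)) -normrM.
apply: lt_trans HM; move: xk yk; rewrite /C /= !ltr_norml => /andP[? ?] /andP[? ?].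
by apply/andP; lra.
Qed.

Hypothesis fcrook : forall dl : R, 0 < dl -> exists n, forall c d : I,
  exists c' d' : I, [/\ btw (\val c) (\val d) (\val c'), btw (\val c') (\val d) (\val d'),
    `|\val (iter n f c') - \val (iter n f d)| <= dl
  & `|\val (iter n f d') - \val (iter n f c)| <= dl].

(** The argument sketched in the introduction: [z] lies over the first
intermediate point, hence near [q] and in [B]; [w] is a point of [B] over the
second one, near [p]. *)
Lemma ilim_hereditarily_indecomposable : hereditarily_indecomposable X.
Proof.
move=> K [_ _ Kc] A B [_ Aco Ac] [_ Bco Bc] KAB.
apply: contrapT => /not_orP[AK BK].
have [q [Kq nAq]] : exists q, K q /\ ~ A q.
  apply: contrapT => H; apply: AK; apply/seteqP; split.
    by rewrite KAB => z; left.
  by move=> z Kz; apply: contrapT => Az; apply: H; exists z.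
have [p [Kp nBp]] : exists p, K p /\ ~ B p.
  apply: contrapT => H; apply: BK; apply/seteqP; split.
    by rewrite KAB => z; right.
  by move=> z Kz; apply: contrapT => Bz; apply: H; exists z.
have hX := ilim_hausdorff fcont.
have /(ilim_nbhsP fcont)[N1 [d1 d10 H1]] : nbhs q (~` A).
  by apply: open_nbhs_nbhs; split => //; apply: closed_openC; exact: compact_closed.
have /(ilim_nbhsP fcont)[N2 [d2 d20 H2]] : nbhs p (~` B).
  by apply: open_nbhs_nbhs; split => //; apply: closed_openC; exact: compact_closed.
have d0 : 0 < Num.min d1 d2 by rewrite lt_min d10.
pose N := maxn N1 N2.
have [dl dl0 H] := cdist_control fcont N d0.
have dl2 : 0 < dl / 2 by rewrite divr_gt0.
have [n Hn] := fcrook dl2.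
have [c' [d' [b1 b2 e1 e2]]] := Hn (coord (N + n) p) (coord (N + n) q).
rewrite -!coord_iter in e1 e2.
have itv (D : set X) z z' a : connected D -> D z -> D z' ->
    btw (\val (coord (N + n) z)) (\val (coord (N + n) z')) (\val a) ->
    exists w, D w /\ coord (N + n) w = a.
  move=> Dc Dz Dz' zz'.
  have : connected ((fun x => \val (coord (N + n) x)) @` D).
    apply: connected_continuous_connected => //.
    exact/continuous_subspaceT/rcoord_cont.
  move=> /connected_intervalP iD.
  have [w Dw wa] : ((fun x => \val (coord (N + n) x)) @` D) (\val a).
    case: zz' => -[h1 h2].
      by apply: (iD (\val (coord (N + n) z)) (\val (coord (N + n) z'))); [exists z|exists z'|rewrite h1 h2].
    by apply: (iD (\val (coord (N + n) z')) (\val (coord (N + n) z))); [exists z'|exists z|rewrite h1 h2].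
  by exists w; split => //; exact: val_inj.
have [z [Kz zc]] := itv K p q c' Kc Kp Kq b1.
have nAz : ~ A z.
  apply: H1; have zq : cdist N q z < dl.
    rewrite /cdist (coord_iter N n z) zc distrC; apply: le_lt_trans e1 _; lra.
  by have := H _ _ zq N1 (leq_maxl _ _); rewrite lt_min => /andP[].
have Bz : B z by move: Kz; rewrite KAB => -[].
have Bq : B q by move: Kq; rewrite KAB => -[].
rewrite -zc in b2.
have [w [Bw wd]] := itv B z q d' Bc Bz Bq b2.
apply: (H2 w) => //; have pw : cdist N p w < dl.
  rewrite /cdist (coord_iter N n w) wd distrC; apply: le_lt_trans e2 _; lra.
by have := H _ _ pw N2 (leq_maxr _ _); rewrite lt_min => /andP[].
Qed.

Lemma ilim_pseudo_arc : pseudo_arc R X.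
Proof.
split.
- exact: ilim_continuum.
- exact: ilim_nondegenerate.
- exact: ilim_hereditarily_indecomposable.
- exact: ilim_chainable.
Qed.

End PseudoArc.

(** * The theorem *)

Section OnUnit.
Variables (R : realType) (f : R -> R).
Local Notation I := (unit_interval R).
Hypotheses (fc : continuous f) (fu : unit_map f) (fe : expand f (3/2))
  (fg : forall dl, 0 < dl -> crooked_within dl f).
Implicit Types (a b c d : I) (n : nat).

Definition on_unit a : I := to_unit (f (\val a)).

Lemma on_unitE a : \val (on_unit a) = f (\val a).
Proof. exact: to_unitK. Qed.

Lemma iter_on_unit n a : \val (iter n on_unit a) = iter n f (\val a).
Proof. by elim: n => [//|n IH]; rewrite [LHS]on_unitE IH. Qed.

Lemma on_unit_cont : continuous on_unit.
Proof.
move=> a; apply: (@continuous_comp _ _ _ (fun b : I => f (\val b)) (@to_unit R)).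
  apply: (@continuous_comp _ _ _ (fun b : I => \val b : R) f); last exact: fc.
  exact: unit_val_cont.
exact: to_unit_cont.
Qed.

Lemma on_unit_cover (p q : R) : 0 <= p -> p < q -> q <= 1 ->
  exists n, forall b, exists a, p <= \val a <= q /\ iter n on_unit a = b.
Proof.
move=> p0 pq q1.
have s1 : 1 <= 3/2 :> R by lra.
have [n Hn] : exists n, 1 <= (3/2) ^+ n * (q - p).
  have [n Hn] := pow_3_2_large (1 / (q - p)).
  by exists n; rewrite -ler_pdivrMr //; lra.
exists n => b.
have [||x [xb fx]] := @expand_cover _ (iter n f) _ p q (\val b) _ _
  (expand_iter n fc fu s1 fe) p0 (ltW pq) q1 Hn (unit01 b).
- exact: cont_iter.
- by move=> x; exact: unit_iter.
have x01 : 0 <= x <= 1 by case/andP: xb => *; apply/andP; lra.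
exists (to_unit x); rewrite to_unitK //; split => //.
by apply: val_inj; rewrite iter_on_unit to_unitK.
Qed.

Lemma on_unit_surj b : exists a, on_unit a = b.
Proof.
have l : 1 <= 3/2 * (1 - 0) :> R by lra.
have [x [xb fx]] := expand_cover fc (fun x _ => fu x) fe (lexx 0) ler01 (lexx 1) l (unit01 b).
by exists (to_unit x); apply: val_inj; rewrite on_unitE to_unitK.
Qed.

Lemma crook_unit (h : R -> R) (dl : R) c d : crook h dl (\val c) (\val d) ->
  exists c' d' : I, [/\ btw (\val c) (\val d) (\val c'),
    btw (\val c') (\val d) (\val d'), `|h (\val c') - h (\val d)| <= dl
    & `|h (\val d') - h (\val c)| <= dl].
Proof.
move=> [c' [d' [b1 b2 e1 e2]]].
have c01 := btw_itv (unit01 c) (unit01 d) b1.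
have d01 := btw_itv c01 (unit01 d) b2.
by exists (to_unit c'), (to_unit d'); rewrite !to_unitK.
Qed.

Lemma on_unit_pseudo_arc : pseudo_arc R (set_type (inverse_limit on_unit)).
Proof.
apply: ilim_pseudo_arc; [exact: on_unit_cont|exact: on_unit_surj|].
move=> dl /fg[[n Hn] _]; exists n => c d.
have [c' [d' [? ? ? ?]]] := crook_unit (Hn _ _ (unit01 c) (unit01 d)).
by exists c', d'; rewrite !iter_on_unit.
Qed.

Lemma on_unit_exact : topologically_exact on_unit.
Proof.
move=> U Uop [a Ua].
have /unit_nbhsP[e e0 He] : nbhs a U by exact: open_nbhs_nbhs.
have /andP[a0 a1] := unit01 a.
have [p [q [p0 pq q1 pqU]]] : exists p q : R, [/\ 0 <= p, p < q, q <= 1 &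
    forall x, p <= x <= q -> `|\val a - x| < e].
  have [a2|a2] := le_or_lt (\val a) (1/2).
    exists (\val a), (\val a + Num.min (e / 2) (1/2)).
    have m0 : 0 < Num.min (e / 2) (1/2) by rewrite lt_min; apply/andP; lra.
    have m1 : Num.min (e / 2) (1/2) <= e / 2 by rewrite ge_min lexx.
    have m2 : Num.min (e / 2) (1/2) <= 1/2 by rewrite ge_min lexx orbT.
    split; try lra; move=> x /andP[? ?]; rewrite ltr_norml; apply/andP; lra.
  exists (\val a - Num.min (e / 2) (1/2)), (\val a).
  have m0 : 0 < Num.min (e / 2) (1/2) by rewrite lt_min; apply/andP; lra.
  have m1 : Num.min (e / 2) (1/2) <= e / 2 by rewrite ge_min lexx.
  have m2 : Num.min (e / 2) (1/2) <= 1/2 by rewrite ge_min lexx orbT.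
  split; try lra; move=> x /andP[? ?]; rewrite ltr_norml; apply/andP; lra.
have [n Hn] := on_unit_cover p0 pq q1.
exists n; apply/seteqP; split => // b _.
have [c [cb cb']] := Hn b; exists c => //.
by apply: He; exact: pqU.
Qed.

Lemma btw_between c d (x : I) : btw (\val c) (\val d) (\val x) -> between c d x.
Proof.
by rewrite /between ge_min le_max => -[[-> ->]|[-> ->]] //; rewrite !orbT.
Qed.

Lemma on_unit_small_folds : small_folds on_unit.
Proof.
move=> la la0 la1; have [_ [be [xi [b0 b1 x0 x1 H]]]] := fg la0.
exists be, xi; split => // a b ab c d ca db.
have hc : f (\val c) = \val a by rewrite -ca on_unitE.
have hd : f (\val d) = \val b by rewrite -db on_unitE.
have cd : `|f (\val c) - f (\val d)| < be by rewrite hc hd.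
have [c' [d' [? ? ? ?]]] := crook_unit (H _ _ (unit01 c) (unit01 d) cd).
exists c', d'; split.
- exact: btw_between.
- exact: btw_between.
- by rewrite on_unitE -hd distrC.
- by rewrite on_unitE -hc distrC.
Qed.

End OnUnit.

Theorem theorem5p7 (R : realType) :
  exists f : unit_interval R -> unit_interval R,
    [/\ continuous f,
        pseudo_arc R (set_type (inverse_limit f)),
        topologically_exact f
      & small_folds f].
Proof.
have [f [fc fu fe fg]] := limit_map R.
exists (on_unit f); split.
- exact: on_unit_cont.
- exact: on_unit_pseudo_arc.
- exact: on_unit_exact.
- exact: on_unit_small_folds.
Qed.
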